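(* Let $s=(s_n)_{n\ge 0}$ be a normalized Hamburger moment sequence which is indeterminate as a Hamburger moment sequence and which is a Stieltjes moment sequence. Let $P_n$ and $Q_n$ be the associated orthonormal polynomials and polynomials of the second kind, let $A,B,C,D$ be the Nevanlinna functions, and let $\alpha(s)$ be the quantity defined in the context. Let $x_{n,1}<\cdots<x_{n,n}$ be the zeros of $P_n$ and let $x^\dagger_{n,1}<\cdots<x^\dagger_{n,n}$ be the zeros of $Q_{n+1}$ ($n\ge 1$). Then for each $k=1,2,\ldots$ the limits $$\xi_k:=\lim_{n\to\infty}x_{n,k},\qquad \xi^\dagger_k:=\lim_{n\to\infty}x^\dagger_{n,k}$$ exist, and they satisfy $$\xi_1<\xi^\dagger_1<\xi_2<\xi^\dagger_2<\cdots.$$ The zeros of the entire function $B(z)\alpha(s)-D(z)$ are exactly the numbers $\xi_k$, $k\ge 1$, and the zeros of the entire function $A(z)\alpha(s)-C(z)$ are exactly the numbers $\xi^\dagger_k$, $k\ge 1$.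
   Context: A normalized Hamburger moment sequence is a sequence $s=(s_n)_{n\ge0}$ of real numbers with $s_0=1$ such that the set $V$ of probability measures $\mu$ on $\mathbb{R}$ with moments of every order and $\int x^n\,d\mu(x)=s_n$ for all $n\ge 0$ is non-empty. It is indeterminate (as a Hamburger moment sequence) if $V$ contains more than one measure (then infinitely many). It is a Stieltjes moment sequence if at least one $\mu\in V$ is supported by $[0,\infty)$. $P_n$, $n\ge 0$, are the orthonormal polynomials for (any) $\mu\in V$, with $\deg P_n=n$ and positive leading coefficient. With $a_n=\int xP_n^2(x)\,d\mu(x)\in\mathbb{R}$ and $b_n=\int xP_n(x)P_{n+1}(x)\,d\mu(x)>0$ (for any $\mu\in V$), both $(P_n)$ and the polynomials of the second kind $(Q_n)$ satisfy $$x y_n=b_n y_{n+1}+a_n y_n+b_{n-1}y_{n-1},\quad n\ge 1,$$ with initial conditions $P_0(x)=1$, $P_1(x)=(x-a_0)/b_0$, $Q_0(x)=0$, $Q_1(x)=1/b_0$. The polynomial $P_n$ has $n$ simple real zeros and $Q_{n+1}$ (of degree $n$) has $n$ simple real zeros; in the Stieltjes case considered here all of them lie in $(0,\infty)$. In the indeterminate case the sequences $(P_n(z))$ and $(Q_n(z))$ are in $\ell^2$ for every $z\in\mathbb{C}$, and the Nevanlinna functions are the entire functions $$A(z)=z\sum_{k=0}^\infty Q_k(z)Q_k(0),\qquad B(z)=-1+z\sum_{k=0}^\infty P_k(z)Q_k(0),$$ $$C(z)=1+z\sum_{k=0}^\infty Q_k(z)P_k(0),\qquad D(z)=z\sum_{k=0}^\infty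 P_k(z)P_k(0).$$ For $s$ indeterminate and Stieltjes the quantity $\alpha(s)$ is defined by $$\alpha(s)=\lim_{x\to-\infty}\frac{D(x)}{B(x)}=\lim_{n\to\infty}\frac{P_n(0)}{Q_n(0)};$$ it is known that both limits exist, coincide and belong to $(-\infty,0]$. *)

(* Defs.v *)
From HB Require Import structures.
From mathcomp Require Import all_boot all_order all_algebra.
From mathcomp Require Import all_classical all_reals all_analysis.
From mathcomp Require Import complex polyrcf.

Set Implicit Arguments.
Unset Strict Implicit.
Unset Printing Implicit Defensive.

Import Order.TTheory GRing.Theory Num.Theory numFieldNormedType.Exports.
Local Open Scope classical_set_scope.
Local Open Scope ring_scope.

Section MomentProblem.
Variable R : realType.

Notation prob := (probability (measurableTypeR R) R).

(* The set V of solutions of the moment problem. *)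
Definition solutions (s : nat -> R) : set prob :=
  [set mu | forall n : nat,
    mu.-integrable setT (fun x : R => (x ^+ n)%:E) /\
    (\int[mu]_x (x ^+ n)%:E = (s n)%:E)%E].

Definition normalized_hamburger (s : nat -> R) : Prop :=
  s 0%N = 1 /\ solutions s !=set0.

(* A measure is a function on all sets, so two measures are to be compared on
   measurable sets only: outside of these its values carry no meaning. *)
Definition indeterminate (s : nat -> R) : Prop :=
  exists mu nu : prob, [/\ solutions s mu, solutions s nu &
    exists2 E : set (measurableTypeR R), measurable E & mu E <> nu E].

Definition stieltjes (s : nat -> R) : Prop :=
  exists2 mu : prob, solutions s mu & mu [set x : R | x < 0] = 0%E.

Definition orthonormal_polys (mu : prob) (P : nat -> {poly R}) : Prop :=
  [/\ forall n, size (P n) = n.+1,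
      forall n, 0 < lead_coef (P n) &
      forall m n, \int[mu]_x ((P m).[x] * (P n).[x]) = (m == n)%:R].

Definition jacobi_a (mu : prob) (P : nat -> {poly R}) (n : nat) : R :=
  \int[mu]_x (x * (P n).[x] ^+ 2).

Definition jacobi_b (mu : prob) (P : nat -> {poly R}) (n : nat) : R :=
  \int[mu]_x (x * (P n).[x] * (P n.+1).[x]).

(* [second_kind_pair a b n] is the pair of Q_n and Q_(n+1), where
   Q_(n+2) = ((x - a_(n+1)) Q_(n+1) - b_n Q_n) / b_(n+1). *)
Fixpoint second_kind_pair (a b : nat -> R) (n : nat) : {poly R} * {poly R} :=
  if n is m.+1 then
    let: (q0, q1) := second_kind_pair a b m in
    (q1, (b m.+1)^-1 *: (('X - (a m.+1)%:P) * q1 - b m *: q0))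
  else (0, (b 0%N)^-1%:P).

Definition second_kind (mu : prob) (P : nat -> {poly R}) (n : nat) : {poly R} :=
  (second_kind_pair (jacobi_a mu P) (jacobi_b mu P) n).1.

(* The k-th smallest real zero of p, counted from k = 1. *)
Definition kth_zero (p : {poly R}) (k : nat) : R := (rootsR p)`_k.-1.

Definition eval_complex (p : {poly R}) (z : R[i]) : R[i] :=
  (map_poly (real_complex R) p).[z].

(* The sum of p_k(z) q_k(0) over k >= 0, for the usual topology of the complex
   plane. *)
Definition kernel_series (p q : nat -> {poly R}) (z : R[i]) : R[i] :=
  limn (series (fun k => eval_complex (p k) z * eval_complex (q k) 0)
        : nat -> (R[i] : numFieldType)).

Definition nevanlinnaA (Q : nat -> {poly R}) (z : R[i]) : R[i] :=
  z * kernel_series Q Q z.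
Definition nevanlinnaB (P Q : nat -> {poly R}) (z : R[i]) : R[i] :=
  -1 + z * kernel_series P Q z.
Definition nevanlinnaC (P Q : nat -> {poly R}) (z : R[i]) : R[i] :=
  1 + z * kernel_series Q P z.
Definition nevanlinnaD (P : nat -> {poly R}) (z : R[i]) : R[i] :=
  z * kernel_series P P z.

(* The limit also equals that of D(x) / B(x) as x tends to -oo. *)
Definition alpha (P Q : nat -> {poly R}) : R :=
  limn (fun n => (P n).[0] / (Q n).[0]).

End MomentProblem.

(* Main.v *)
(* Let [D_n], [B_n], [C_n], [A_n] be the partial sums of the Nevanlinna series.
   The Christoffel-Darboux identities give
     P_(n+1)(z) / Q_(n+1)(0) = D_n(z) - alpha_(n+1) B_n(z),
     Q_(n+1)(z) / Q_(n+1)(0) = C_n(z) - alpha_(n+1) A_n(z),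
   where alpha_n = P_n(0) / Q_n(0), so that these normalized polynomials converge
   pointwise to F = D - alpha B and G = C - alpha A, and A F - B G = 1: F and G
   have no common zero.  Their zeros are positive, decrease with n and interlace,
   and the values at -1 bound the sums of their inverses.  By dominated
   convergence in the finite products (so without complex analysis) the zeros of F
   and G are exactly the limits of the zeros of P_n and Q_(n+1); the absence of a
   common zero makes the interlacing of the limits strict.

   The square summability of P_n(z) and Q_n(z) comes from indeterminacy.  If w is
   the Cauchy transform at z of a solution, Bessel's inequality applied to
   1 / (t - z) makes w P_n(z) + Q_n(z) square summable.  Two solutions with the
   same transform off the real axis agree, since 1 / (1 + T^(2^m)) with
   T = (t - a) / r decomposes into simple fractions and tends to the indicator of
   [|T| < 1]; hence two values of w occur at some z0, and a transfer argument
   moves the summability from z0 to every z. *)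

Require Import Defs.
From HB Require Import structures.
From mathcomp Require Import all_boot all_order all_algebra.
From mathcomp Require Import all_classical all_reals all_analysis.
From mathcomp Require Import measurable_realfun complex polyrcf.
From mathcomp Require Import ring lra.

Import Order.TTheory GRing.Theory Num.Theory numFieldNormedType.Exports.
Local Open Scope classical_set_scope.
Local Open Scope ring_scope.
Local Open Scope complex_scope.
Set Implicit Arguments.
Unset Strict Implicit.
Unset Printing Implicit Defensive.

Import Normc.

(** * Complex evaluation *)

Section ComplexTools.
Variable R : realType.
Implicit Types (x y z : R[i]) (p q : {poly R}) (u v : nat -> R[i]).

Lemma normc_leD x y : normc (x + y) <= normc x + normc y.
Proof. exact: (@le_normcD R x y). Qed.

Lemma normc_ge0 z : 0 <= normc z.
Proof. by case: z => a b; exact: sqrtr_ge0. Qed.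

Lemma normcNE z : normc (- z) = normc z.
Proof. exact: (@normcN R z). Qed.

Lemma normc_real (a : R) : normc a%:C = `|a|.
Proof. by rewrite /= expr0n addr0 sqrtr_sqr. Qed.

Lemma normc_sqrE z : normc z ^+ 2 = complex.Re z ^+ 2 + complex.Im z ^+ 2.
Proof. by case: z => a b; rewrite /normc sqr_sqrtr// addr_ge0 ?sqr_ge0. Qed.

Lemma normc_ge_normRe z : `|complex.Re z| <= normc z.
Proof.
rewrite -ler_sqr ?nnegrE ?normc_ge0// normc_sqrE real_normK ?num_real//.
by rewrite lerDl sqr_ge0.
Qed.

Lemma normc_ge_normIm z : `|complex.Im z| <= normc z.
Proof.
rewrite -ler_sqr ?nnegrE ?normc_ge0// normc_sqrE real_normK ?num_real//.
by rewrite lerDr sqr_ge0.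
Qed.

Lemma normc_leB x y : normc x - normc y <= normc (x - y).
Proof. by rewrite lerBlDr -{1}(subrK y x) normc_leD. Qed.

Lemma normc_gt0 z : (0 < normc z) = (z != 0).
Proof.
rewrite lt_neqAle normc_ge0 andbT eq_sym; congr negb.
by apply/eqP/eqP => [/eq0_normc//|->]; rewrite normc0.
Qed.

Lemma normc_prod (I : Type) (r : seq I) (Pr : pred I) (F : I -> R[i]) :
  normc (\prod_(i <- r | Pr i) F i) = \prod_(i <- r | Pr i) normc (F i).
Proof. by apply: big_morph; [exact: normcM|exact: normc1]. Qed.

Lemma eval_complexD p q z :
  eval_complex (p + q) z = eval_complex p z + eval_complex q z.
Proof. by rewrite /eval_complex rmorphD hornerD. Qed.

Lemma eval_complexB p q z :
  eval_complex (p - q) z = eval_complex p z - eval_complex q z.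
Proof. by rewrite /eval_complex rmorphB hornerD hornerN. Qed.

Lemma eval_complex0 z : eval_complex (0 : {poly R}) z = 0.
Proof. by rewrite /eval_complex rmorph0 horner0. Qed.

Lemma eval_complex1 z : eval_complex (1 : {poly R}) z = 1.
Proof. by rewrite /eval_complex rmorph1 hornerC. Qed.

Lemma eval_complexM p q z :
  eval_complex (p * q) z = eval_complex p z * eval_complex q z.
Proof. by rewrite /eval_complex rmorphM hornerM. Qed.

Lemma eval_complexC (c : R) z : eval_complex c%:P z = c%:C.
Proof. by rewrite /eval_complex map_polyC hornerC. Qed.

Lemma eval_complexX z : eval_complex 'X z = z.
Proof. by rewrite /eval_complex map_polyX hornerX. Qed.

Lemma eval_complexZ (c : R) p z :
  eval_complex (c *: p) z = c%:C * eval_complex p z.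
Proof. by rewrite -mul_polyC eval_complexM eval_complexC. Qed.

Lemma eval_complex_real p (a : R) : eval_complex p a%:C = p.[a]%:C.
Proof. by rewrite /eval_complex horner_map. Qed.

Lemma eval_complex_three_term (a b : nat -> R) (y : nat -> {poly R}) z :
  (forall n, 'X * y n.+1 = b n.+1 *: y n.+2 + a n.+1 *: y n.+1 + b n *: y n) ->
  forall n, z * eval_complex (y n.+1) z = (b n.+1)%:C * eval_complex (y n.+2) z
    + (a n.+1)%:C * eval_complex (y n.+1) z + (b n)%:C * eval_complex (y n) z.
Proof.
move=> yS n; have := congr1 (fun p => eval_complex p z) (yS n).
by rewrite !eval_complexD eval_complexM !eval_complexZ eval_complexX.
Qed.

Lemma eval_complex_prodXsubC (n : nat) (x : nat -> R) z :
  eval_complex (\prod_(i < n) ('X - (x i)%:P)) z = \prod_(i < n) (z - (x i)%:C).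
Proof.
rewrite /eval_complex rmorph_prod horner_prod; apply: eq_bigr => i _.
by rewrite rmorphB/= map_polyX map_polyC hornerXsubC.
Qed.

(** Membership in l^2, encoded by a bound on partial sums so that every comparison is one of finite
    sums. *)
Definition sqsum_bounded u :=
  exists M : R, forall n, \sum_(k < n) normc (u k) ^+ 2 <= M.

Lemma sqsum_boundedZ c u : sqsum_bounded u -> sqsum_bounded (fun k => c * u k).
Proof.
move=> [M uM]; exists (normc c ^+ 2 * M) => n.
under eq_bigr do rewrite normcM exprMn.
by rewrite -mulr_sumr ler_wpM2l ?sqr_ge0.
Qed.

Lemma sqsum_boundedD u v : sqsum_bounded u -> sqsum_bounded v ->
  sqsum_bounded (fun k => u k + v k).
Proof.
(* The factor 2 comes from [(x + y)^2 <= 2 (x^2 + y^2)]. *)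
move=> [M uM] [N vN]; exists (2 * (M + N)) => n.
apply: (@le_trans _ _ (\sum_(k < n) 2 * (normc (u k) ^+ 2 + normc (v k) ^+ 2))).
  apply: ler_sum => k _; have := normc_leD (u k) (v k).
  have := normc_ge0 (u k + v k); have := normc_ge0 (u k); have := normc_ge0 (v k).
  move: (normc _) (normc _) (normc _) => a b c c0 b0 a0 h.
  have h2 := ler_pM a0 a0 h h; rewrite -expr2 in h2.
  apply: (le_trans h2); have := sqr_ge0 (b - c); rewrite !expr2; lra.
rewrite -mulr_sumr; apply: ler_wpM2l => //; rewrite big_split/=.
exact: lerD (uM n) (vN n).
Qed.

End ComplexTools.

(** * Integrals and the moment functional *)

Section Integrals.
Variables (R : realType) (mu : probability R R).
Implicit Types (f g : R -> R) (c : R).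

Notation intg f := (mu.-integrable setT (EFin \o f)).

Lemma intgD f g : intg f -> intg g -> intg (fun t => f t + g t).
Proof. by move=> fi gi; exact: (integrableD measurableT fi gi). Qed.

Lemma intgZ c f : intg f -> intg (fun t => c * f t).
Proof. by move=> fi; exact: (integrableZl measurableT c fi). Qed.

Lemma intg_sum (I : Type) (r : seq I) (F : I -> R -> R) :
  (forall i, intg (F i)) -> intg (fun t => \sum_(i <- r) F i t).
Proof.
move=> Fi; rewrite [X in mu.-integrable _ X](_ : _ =
  (fun t => (\sum_(i <- r) (EFin \o F i) t)%E)).
  exact: integrable_sum.
by apply/funext => t /=; rewrite sumEFin.
Qed.

Lemma Rintegral_sum (I : Type) (r : seq I) (F : I -> R -> R) :
  (forall i, intg (F i)) ->
  \int[mu]_t (\sum_(i <- r) F i t) = \sum_(i <- r) \int[mu]_t F i t.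
Proof.
move=> Fi; elim: r => [|i r IH].
  rewrite big_nil; under eq_Rintegral do rewrite big_nil.
  by rewrite Rintegral_cst// mul0r.
rewrite big_cons -IH -RintegralD//; last exact: intg_sum.
by apply: eq_Rintegral => t _; rewrite big_cons.
Qed.

Lemma measurable_horner (p : {poly R}) : measurable_fun setT (horner p).
Proof. by apply: continuous_measurable_fun; exact: continuous_horner. Qed.

Lemma bounded_mul_intg f g M : measurable_fun setT f ->
  (forall t, `|f t| <= M) -> intg g -> intg (fun t => f t * g t).
Proof.
move=> mf fM gi; rewrite [X in mu.-integrable _ X](_ : _ =
   ((EFin \o f) \* (EFin \o g))%E)//.
apply: integrableMr => //; exists M; split; first exact: num_real.
by move=> x Mx t _ /=; apply: le_trans (fM t) (ltW Mx).
Qed.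

Lemma intg_cst c : intg (fun=> c).
Proof. by apply: finite_measure_integrable_cst. Qed.

Lemma bounded_intg f M : measurable_fun setT f -> (forall t, `|f t| <= M) ->
  intg f.
Proof.
move=> mf fM; have := bounded_mul_intg mf fM (intg_cst 1).
by under eq_fun do rewrite mulr1.
Qed.

End Integrals.

Section MomentFunctional.
Variables (R : realType) (s : nat -> R).
Implicit Types (p q : {poly R}).

(** Integration against any solution, written with the moments alone: facts obtained from different
    solutions become statements about a single functional. *)
Definition moment_functional p : R := \sum_(i < size p) p`_i * s i.

Lemma moment_functional_widen n p : (size p <= n)%N ->
  moment_functional p = \sum_(i < n) p`_i * s i.
Proof.
move=> pn; rewrite /moment_functional (big_ord_widen n (fun i => p`_i * s i) pn).
rewrite [RHS](bigID (fun i : 'I_n => (i < size p)%N)) /= [X in _ = _ + X]big1 ?addr0//.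
by move=> i; rewrite -leqNgt => /leq_sizeP -> //; rewrite mul0r.
Qed.

Lemma moment_functional_is_linear : scalar moment_functional.
Proof.
move=> c p q; pose n := maxn (size p) (size q).
have pn : (size p <= n)%N by rewrite leq_maxl.
have qn : (size q <= n)%N by rewrite leq_maxr.
have cn : (size (c *: p + q)%R <= n)%N.
  by rewrite (leq_trans (size_polyD _ _))// geq_max qn (leq_trans (size_scale_leq _ _)).
rewrite !(@moment_functional_widen n)// mulr_sumr -big_split/=.
by apply: eq_bigr => i _; rewrite coefD coefZ mulrDl mulrA.
Qed.

HB.instance Definition _ :=
  GRing.isLinear.Build R {poly R} R *%R moment_functional moment_functional_is_linear.

Definition has_moments (mu : probability R R) := forall n : nat,
  mu.-integrable setT (fun t : R => (t ^+ n)%:E) /\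
  (\int[mu]_t (t ^+ n)%:E = (s n)%:E)%E.

Variable mu : probability R R.
Hypothesis mus : has_moments mu.

Lemma intg_poly p : mu.-integrable setT (EFin \o horner p).
Proof.
rewrite (_ : horner p = fun t => \sum_(i < size p) p`_i * t ^+ i).
  apply: intg_sum => i; apply: intgZ; exact: (mus i).1.
by apply/funext => t; rewrite horner_coef.
Qed.

Lemma Rintegral_poly p : \int[mu]_t p.[t] = moment_functional p.
Proof.
under eq_Rintegral do rewrite horner_coef.
rewrite Rintegral_sum; last by move=> i; apply: intgZ; exact: (mus i).1.
apply: eq_bigr => i _; rewrite RintegralZl//; last by exact: (mus i).1.
by congr (_ * _); rewrite /Rintegral (mus i).2.
Qed.

End MomentFunctional.

Section Standard.
Variables (R : realType).
Implicit Types mu : probability (measurableTypeR R) R.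

Let idR : measurableTypeR R -> R := idfun.
#[local] HB.instance Definition _ :=
  @isMeasurableFun.Build _ _ _ _ idR (@measurable_id _ _ setT).

(* [measurableTypeR R] and [R] carry the same sigma-algebra under two displays, and
   the moments are integrals over the latter, orthonormality over the former. *)
Definition std_prob mu : probability R R := distribution mu idR.

Lemma std_probE mu A : std_prob mu A = mu A.
Proof. by []. Qed.

Lemma has_moments_std s mu : solutions s mu -> has_moments s (std_prob mu).
Proof. by move=> h n; exact: h. Qed.

Lemma Rintegral_std mu (f : R -> R) : (std_prob mu).-integrable setT (EFin \o f) ->
  \int[mu]_x f x = \int[std_prob mu]_x f x.
Proof.
move=> /[dup] /measurable_int mf /integrableP[_ fi].
have mf' : measurable_fun [set: measurableTypeR R] ((EFin \o f) \o idR).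
  exact: measurableT_comp.
rewrite /Rintegral [in RHS]integral_pushforward//.
apply/integrableP; split => //; move: fi.
by rewrite ge0_integral_pushforward//; exact: measurableT_comp.
Qed.

End Standard.

(** * A measure is determined by its Cauchy transform *)

Section Uniqueness.
Variables (R : realType) (mu nu : probability R R).
Implicit Types (f g : R -> R) (F G : R -> R[i]) (z c : R[i]).

(** Integrability is carried along with equality, so that linear combinations need no side
    conditions. *)
Definition same_integral f :=
  [/\ mu.-integrable setT (EFin \o f), nu.-integrable setT (EFin \o f) &
      \int[mu]_t f t = \int[nu]_t f t].

Definition same_cintegral F :=
  same_integral (fun t => complex.Re (F t)) /\
  same_integral (fun t => complex.Im (F t)).

Lemma same_integralD f g :
  same_integral f -> same_integral g -> same_integral (fun t => f t + g t).
Proof.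
move=> [fm fn fE] [gm gn gE]; split; [exact: intgD|exact: intgD|].
by rewrite !RintegralD// fE gE.
Qed.

Lemma same_integralZ (k : R) f :
  same_integral f -> same_integral (fun t => k * f t).
Proof.
move=> [fm fn fE]; split; [exact: intgZ|exact: intgZ|].
by rewrite !RintegralZl// fE.
Qed.

Lemma same_cintegralD F G : same_cintegral F -> same_cintegral G ->
  same_cintegral (fun t => F t + G t).
Proof.
move=> [F1 F2] [G1 G2]; split.
  rewrite [X in same_integral X](_ : _ =
    fun t => complex.Re (F t) + complex.Re (G t)).
    exact: same_integralD.
  by apply/funext => t; rewrite raddfD.
rewrite [X in same_integral X](_ : _ =
    fun t => complex.Im (F t) + complex.Im (G t)).
  exact: same_integralD.
by apply/funext => t; rewrite raddfD.
Qed.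

Lemma same_cintegralZ c F : same_cintegral F ->
  same_cintegral (fun t => c * F t).
Proof.
move=> [F1 F2]; split.
  rewrite [X in same_integral X](_ : _ = fun t =>
    complex.Re c * complex.Re (F t) + (- complex.Im c) * complex.Im (F t)).
    by apply: same_integralD; exact: same_integralZ.
  by apply/funext => t; case: c (F t) => [a b] [u v] /=; rewrite mulNr.
rewrite [X in same_integral X](_ : _ = fun t =>
    complex.Re c * complex.Im (F t) + complex.Im c * complex.Re (F t)).
  by apply: same_integralD; exact: same_integralZ.
by apply/funext => t; case: c (F t) => [a b] [u v] /=.
Qed.

Hypothesis same_transform : forall z, complex.Im z != 0 ->
  same_cintegral (fun t => (t%:C - z)^-1).

Lemma real_neq_nonreal (x : R) z : complex.Im z != 0 -> x%:C - z != 0.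
Proof.
by apply: contraNneq => /eqP; rewrite subr_eq0 => /eqP <-.
Qed.

(* 1 / (u^2 - w^2) = (1 / (u - w) - 1 / (u + w)) / (2 w), with w a square root of z. *)
Lemma same_transform_expn2 m (a r : R) z : r != 0 -> complex.Im z != 0 ->
  same_cintegral (fun t => ((((t - a) / r) ^+ (2 ^ m))%:C - z)^-1).
Proof.
move=> r0; elim: m z => [|m IH] z z0.
  rewrite [X in same_cintegral X](_ : _ =
      fun t => r%:C * (t%:C - (a%:C + r%:C * z))^-1).
    apply: same_cintegralZ; apply: same_transform.
    by case: z z0 => u v /= z0; rewrite mul0r add0r addr0 mulf_neq0.
  apply/funext => t; rewrite expn0 expr1.
  have rC : r%:C != 0 :> R[i] by rewrite fmorph_eq0.
  have -> : ((t - a) / r)%:C - z = r%:C ^-1 * (t%:C - (a%:C + r%:C * z)).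
    rewrite rmorphM rmorphB/= fmorphV.
    by field.
  by rewrite invfM invrK.
pose w := sqrtc z.
have wz : w ^+ 2 = z by rewrite sqr_sqrtc.
have w0 : complex.Im w != 0.
  apply: contraNneq z0 => w0; rewrite -wz; case: w w0 {wz} => u v /= ->.
  by rewrite mulr0 mul0r addr0.
have Nw0 : complex.Im (- w) != 0 by rewrite raddfN oppr_eq0.
have w00 : w != 0 by apply: contraNneq w0 => ->.
rewrite [X in same_cintegral X](_ : _ = fun t =>
    (2 * w)^-1 * ((((t - a) / r) ^+ (2 ^ m))%:C - w)^-1 +
    (- (2 * w)^-1) * ((((t - a) / r) ^+ (2 ^ m))%:C - - w)^-1).
  by apply: same_cintegralD; apply: same_cintegralZ; exact: IH.
apply/funext => t; rewrite expnSr exprM.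
set x := (_ ^+ (2 ^ m)).
have := real_neq_nonreal x w0; have := real_neq_nonreal x Nw0.
have := real_neq_nonreal (x ^+ 2) z0; rewrite -wz rmorphXn/=.
move: (x%:C) => y; rewrite opprK => h1 h2 h3.
by field; rewrite h1 h2 h3 w00.
Qed.

(** The imaginary part of [1 / (x - i)] is [1 / (1 + x^2)], taken here at
    [x = ((t - a) / r)^(2^m)]. *)
Lemma same_bump m (a r : R) : r != 0 ->
  same_integral (fun t => (1 + ((t - a) / r) ^+ (2 ^ m.+1))^-1).
Proof.
move=> r0; have i0 : complex.Im ('i : R[i]) != 0 by rewrite /= oner_eq0.
have [_] := same_transform_expn2 m a r0 i0.
rewrite [X in same_integral X -> _](_ : _ =
  fun t => (1 + ((t - a) / r) ^+ (2 ^ m.+1))^-1)//.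
apply/funext => t; rewrite expnSr exprM; set x := (_ ^+ (2 ^ m)).
by rewrite /= !sub0r subr0 sqrrN expr1n mulNr opprK mul1r addrC.
Qed.

(** Dominated convergence for both measures; the constant 1 dominates and has finite integral. *)
Lemma same_integral_lim (f_ : nat -> R -> R) (f : R -> R) :
  (forall n, measurable_fun setT (f_ n)) -> (forall n t, `|f_ n t| <= 1) ->
  (forall n, same_integral (f_ n)) -> (forall t, f_ ^~ t @ \oo --> f t) ->
  same_integral f.
Proof.
move=> mf f1 fE fl.
have mlim : measurable_fun setT (EFin \o f).
  by apply/measurable_EFinP; apply: (@measurable_fun_cvg _ _ _ _ f_).
have fle t : `|f t| <= 1.
  apply: (@cvgr_to_le _ \oo _ _ (fun n => `|f_ n t|)); last exact: nearW.
  by apply: cvg_norm; exact: fl.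
have key (rho : probability R R) : (rho.-integrable setT (EFin \o f)) /\
    \int[rho]_t f_ n t @[n --> \oo] --> \int[rho]_t f t.
  have [|||||fi _ fc] := @dominated_convergence _ _ _ rho setT measurableT
      (fun n => EFin \o f_ n) (EFin \o f) (cst 1%E).
  - by move=> n; apply/measurable_EFinP.
  - exact: mlim.
  - by apply: aeW => t _; apply: cvg_EFin; [exact: nearW|exact: fl].
  - exact: (intg_cst rho 1).
  - by apply: aeW => t n _; rewrite /= lee_fin.
  split => //; apply: fine_cvg; move: fc.
  rewrite fineK//; exact: integrable_fin_num.
have [fm cm] := key mu; have [fn cn] := key nu; split => //.
have E : (fun n => \int[mu]_t f_ n t) = (fun n => \int[nu]_t f_ n t).
  by apply/funext => n; case: (fE n).
by rewrite E in cm; exact: (cvg_unique _ cm cn).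
Qed.

(** Pointwise limit of the bumps; at the two edges the powers are constantly 1, whence the value
    [1/2]. *)
Definition window (a r t : R) : R :=
  if `|t - a| < r then 1 else if `|t - a| == r then 2^-1 else 0.

Lemma cvg_bump (x : R) : (1 + x ^+ (2 ^ m.+1))^-1 @[m --> \oo] -->
  (if `|x| < 1 then 1 else if `|x| == 1 then 2^-1 else 0 : R).
Proof.
have abs m : x ^+ (2 ^ m.+1) = `|x| ^+ (2 ^ m.+1).
  by rewrite expnS !exprM real_normK ?num_real.
under eq_fun do rewrite abs.
(* This compares the powers with geometric sequences of ratio [|x|] or [1 / |x|]. *)
have e_ge m : (m <= 2 ^ m.+1)%N.
  by rewrite (leq_trans (ltnW (ltn_expl m (ltnSn 1))))// leq_exp2l.
have [x1|x1|x1] := ltgtP `|x| 1.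
- suff : (1 + `|x| ^+ (2 ^ m.+1))^-1 @[m --> \oo] --> (1 + 0 : R)^-1.
    by rewrite addr0 invr1.
  apply: cvgV; first by rewrite addr0 oner_neq0.
  apply: cvgD; first exact: cvg_cst.
  apply: (@squeeze_cvgr _ _ _ _ (cst 0) (fun m => `|x| ^+ m)).
  + apply: nearW => m; rewrite exprn_ge0//=.
    by apply: ler_wiXn2l => //; exact: ltW.
  + exact: cvg_cst.
  + by apply: cvg_expr; rewrite normr_id.
- have x0 : 0 < `|x| by apply: lt_trans x1.
  apply: (@squeeze_cvgr _ _ _ _ (cst 0) (fun m => `|x|^-1 ^+ m)).
  + apply: nearW => m; rewrite invr_ge0 addr_ge0 ?exprn_ge0//=.
    have xm : `|x| ^+ m <= 1 + `|x| ^+ (2 ^ m.+1).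
      by apply: le_trans (ler_weXn2l (ltW x1) (e_ge m)) _; rewrite lerDr.
    by rewrite exprVn lef_pV2 ?posrE ?addr_gt0 ?exprn_gt0.
  + exact: cvg_cst.
  + by apply: cvg_expr; rewrite ger0_norm ?invr_ge0// invf_lt1.
- by under eq_fun do rewrite x1 expr1n; exact: cvg_cst.
Qed.

Lemma same_window (a r : R) : 0 < r -> same_integral (window a r).
Proof.
move=> r0; apply: (@same_integral_lim
  (fun m t => (1 + ((t - a) / r) ^+ (2 ^ m.+1))^-1)).
- move=> m; apply: continuous_measurable_fun => t.
  have E : (fun u => 1 + ((u - a) / r) ^+ (2 ^ m.+1)) =
      horner (1 + (r^-1 *: ('X - a%:P)) ^+ (2 ^ m.+1)).
    apply/funext => u.
    by rewrite hornerD hornerC horner_exp hornerZ hornerXsubC mulrC.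
  apply: cvgV; last first.
    have := @continuous_horner R (1 + (r^-1 *: ('X - a%:P)) ^+ (2 ^ m.+1)) t.
    by rewrite -E.
  by rewrite gt_eqF// ltr_wpDr// expnS exprM exprn_ge0// sqr_ge0.
- move=> m t; have h : 0 <= ((t - a) / r) ^+ (2 ^ m.+1).
    by rewrite expnS exprM exprn_ge0// sqr_ge0.
  by rewrite ger0_norm ?invr_ge0 ?addr_ge0// invf_le1 ?lerDl// ltr_wpDr.
- by move=> m; apply: same_bump; rewrite gt_eqF.
- move=> t; have := @cvg_bump ((t - a) / r).
  rewrite /window normrM normfV (gtr0_norm r0) ltr_pdivrMr// mul1r.
  suff -> : (`|t - a| / r == 1) = (`|t - a| == r) by [].
  apply/eqP/eqP => [h|->]; last by rewrite divff// gt_eqF.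
  by rewrite -[RHS]mul1r -h divfK// gt_eqF.
Qed.

Lemma same_indic_itvoc (a b : R) : a < b -> same_integral \1_(`]a, b]).
Proof.
move=> ab; pose r := (b - a) / 2; have r0 : 0 < r by rewrite divr_gt0 ?subr_gt0.
(* The windows are shifted to the right by [w n], which tends to 0: then [a] is always outside and
   [b] eventually inside, so the edge value [1/2] does not survive in the limit. *)
pose w n : R := n.+1%:R^-1; pose c n := (a + b) / 2 + w n.
apply: (@same_integral_lim (fun n => window (c n) r)).
- by move=> n; have [/measurable_int/measurable_EFinP] := same_window (c n) r0.
- move=> n t; rewrite /window; case: ifP => _; first by rewrite normr1.
  case: ifP => _; last by rewrite normr0.
  by rewrite ger0_norm ?invr_ge0// invf_le1// ler1n.
- by move=> n; exact: same_window.
move=> t; apply/cvgrPdist_lt => e e0.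
have inv_small d : 0 < d -> \forall n \near \oo, w n < d.
  by move=> d0; exact: near_infty_natSinv_lt (PosNum d0).
have inv_gt0 n : 0 < w n by rewrite invr_gt0.
clearbody w; rewrite indicE; have [ta|ta] := leP t a.
  near=> n; rewrite memNset; last by rewrite /= in_itv/= ltNge ta.
  rewrite /window /c [`|t - _|]ltr0_norm; last first.
    have := inv_gt0 n; lra.
  have := inv_gt0 n; move=> h.
  rewrite ifF; last by apply/negbTE; rewrite -leNgt /r; lra.
  rewrite ifF; first by rewrite subrr normr0.
  by apply/negbTE; rewrite gt_eqF// /r; lra.
have [tb|tb] := leP t b.
  rewrite mem_set/=; last by rewrite in_itv/= ta tb.
  near=> n; have h := inv_gt0 n.
  have h2 : w n < t - a.
    near: n; apply: inv_small; by rewrite subr_gt0.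
  by rewrite /window ifT ?subrr ?normr0// /c /r ltr_norml; lra.
rewrite memNset/=; last by rewrite in_itv/= ta leNgt tb.
near=> n; have h := inv_gt0 n.
have h2 : w n < t - b.
  near: n; apply: inv_small; by rewrite subr_gt0.
rewrite /window /c [`|t - _|]gtr0_norm; last by lra.
rewrite ifF; last by apply/negbTE; rewrite -leNgt /r; lra.
rewrite ifF; first by rewrite subrr normr0.
by apply/negbTE; rewrite gt_eqF// /r; lra.
Unshelve. all: by end_near. Qed.

Lemma same_measure_itvoc (a b : R) : mu `]a, b]%classic = nu `]a, b]%classic.
Proof.
have [ab|ba] := ltP a b; last by rewrite set_itv_ge ?measure0// bnd_simp -leNgt.
have [_ _] := same_indic_itvoc ab.
rewrite /Rintegral !integral_indic// !setIT => h.
by rewrite -[LHS]fineK ?fin_num_measure// h fineK ?fin_num_measure.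
Qed.

End Uniqueness.

(** Each measure is the Lebesgue-Stieltjes measure of its distribution function, and such a measure
    is determined by its values on half-open intervals. *)
Lemma probability_eq_itvoc (R : realType)
    (mu nu : probability (measurableTypeR R) R) :
  (forall a b : R, mu `]a, b]%classic = nu `]a, b]%classic) ->
  forall E, measurable E -> mu E = nu E.
Proof.
move=> H E mE; rewrite -(lebesgue_stieltjes_cdf_id mu mE).
apply: lebesgue_stieltjes_measure_unique => // X [[a b]/= _ <-].
by rewrite lebesgue_stieltjes_cdf_id.
Qed.

(** * Orthonormal polynomials *)

Section OrthonormalPolynomials.
Variables (R : realFieldType) (L : {linear {poly R} -> R | *%R}).
Variable P : nat -> {poly R}.
Hypothesis size_P : forall n, size (P n) = n.+1.
Hypothesis lead_P : forall n, 0 < lead_coef (P n).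
Hypothesis ortho_P : forall m n, L (P m * P n) = (m == n)%:R.
Implicit Types p q : {poly R}.

Lemma orthonormal_coef n (c : nat -> R) j : (j < n)%N ->
  L ((\sum_(k < n) c k *: P k) * P j) = c j.
Proof.
move=> jn; rewrite mulr_suml linear_sum/= (bigD1 (Ordinal jn))//= big1.
  by rewrite -scalerAl linearZ/= ortho_P eqxx mulr1 addr0.
move=> k; rewrite -val_eqE/= => kj.
by rewrite -scalerAl linearZ/= ortho_P (negPf kj) mulr0.
Qed.

(** Induction on the degree, a multiple of [P n] cancelling the top coefficient; orthonormality then
    identifies the coefficients. *)
Lemma orthonormal_span n p : (size p <= n)%N ->
  p = \sum_(k < n) L (p * P k) *: P k.
Proof.
move=> pn; suff [c pE] : exists c : nat -> R, p = \sum_(k < n) c k *: P k.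
  rewrite {1}pE; apply: eq_bigr => k _; congr (_ *: _).
  by rewrite pE orthonormal_coef.
elim: n p pn => [|n IH] p.
  by rewrite leqn0 size_poly_eq0 => /eqP ->; exists (fun=> 0); rewrite big_ord0.
move=> pn; pose d := p`_n / lead_coef (P n).
have [|c qE] := IH (p - d *: P n).
  apply/leq_sizeP => j; rewrite leq_eqVlt => /predU1P[<-|nj].
    rewrite coefB coefZ /d; have := lead_P n; rewrite lead_coefE size_P/= => h.
    by rewrite divfK ?subrr// gt_eqF.
  rewrite coefB coefZ [p`_j]nth_default ?(leq_trans pn)//.
  by rewrite nth_default ?size_P// mulr0 subr0.
exists (fun k => if k == n then d else c k).
rewrite big_ord_recr/= eqxx.
under eq_bigr => k _ do rewrite (ltn_eqF (ltn_ord k)).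
by rewrite -qE subrK.
Qed.

Lemma orthonormal_low n p : (size p <= n)%N -> L (p * P n) = 0.
Proof.
move=> pn; rewrite (orthonormal_span pn) mulr_suml linear_sum/= big1// => k _.
by rewrite -scalerAl linearZ/= ortho_P (ltn_eqF (ltn_ord k)) mulr0.
Qed.

Lemma functional_sqr n p : (size p <= n)%N ->
  L (p * p) = \sum_(k < n) L (p * P k) ^+ 2.
Proof.
move=> pn; rewrite {2}(orthonormal_span pn) mulr_sumr linear_sum/=.
by apply: eq_bigr => k _; rewrite -scalerAr linearZ/=.
Qed.

(** By Parseval, the value 0 would make every Fourier coefficient of [p] vanish. *)
Lemma functional_sqr_gt0 p : p != 0 -> 0 < L (p * p).
Proof.
move=> p0; rewrite (functional_sqr (leqnn _)) lt_neqAle sumr_ge0 ?andbT; last first.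
  by move=> k _; exact: sqr_ge0.
apply: contraNneq p0 => /esym/eqP; rewrite psumr_eq0; last by move=> k _; exact: sqr_ge0.
move=> /allP h; rewrite (orthonormal_span (leqnn (size p))) big1// => k _.
have := h k (mem_index_enum _); rewrite /= sqrf_eq0 => /eqP ->.
by rewrite scale0r.
Qed.

Let a n := L ('X * P n * P n).
Let b n := L ('X * P n * P n.+1).

(** In fact [b n] is the ratio [d] of two leading coefficients: [X P_n - d P_(n+1)] has degree at
    most [n], hence is orthogonal to [P_(n+1)]. *)
Lemma jacobi_b_gt0 n : 0 < b n.
Proof.
pose d := lead_coef (P n) / lead_coef (P n.+1).
have d0 : 0 < d by rewrite divr_gt0.
suff -> : b n = d by [].
have : L (('X * P n - d *: P n.+1) * P n.+1) = 0.
  apply: orthonormal_low; apply/leq_sizeP => j.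
  rewrite leq_eqVlt => /predU1P[<-|nj].
    rewrite coefB coefZ coefXM/= /d.
    have := lead_P n.+1; rewrite !lead_coefE !size_P/= => h.
    by rewrite divfK ?subrr// gt_eqF.
  rewrite coefB coefZ coefXM; case: j nj => // j; rewrite ltnS/= => nj.
  by rewrite !nth_default ?size_P// mulr0 subr0.
rewrite mulrBl linearB/= -scalerAl linearZ/= ortho_P eqxx mulr1 => /eqP.
by rewrite subr_eq0 => /eqP.
Qed.

Lemma three_term0 : 'X * P 0 = b 0 *: P 1 + a 0 *: P 0.
Proof.
have s2 : (size ('X * P 0)%R <= 2)%N.
  by rewrite (leq_trans (size_polyMleq _ _))// size_polyX size_P.
by rewrite (orthonormal_span s2) !big_ord_recr big_ord0/= add0r addrC.
Qed.

Lemma three_term n :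
  'X * P n.+1 = b n.+1 *: P n.+2 + a n.+1 *: P n.+1 + b n *: P n.
Proof.
have s2 : (size ('X * P n.+1)%R <= n.+3)%N.
  by rewrite (leq_trans (size_polyMleq _ _))// size_polyX size_P.
rewrite (orthonormal_span s2) !big_ord_recr/= big1 ?add0r.
  rewrite -/(a n.+1) -/(b n.+1).
  have -> : L ('X * P n.+1 * P n) = b n by rewrite /b; congr (L _); ring.
  by rewrite addrC addrAC addrA.
(* Here [k < n]: once [X] is moved onto [P_k], the degree is at most [n] and orthogonality to
   [P_(n+1)] applies. *)
move=> k _; have -> : 'X * P n.+1 * P k = ('X * P k) * P n.+1 by ring.
rewrite orthonormal_low ?scale0r//.
by rewrite (leq_trans (size_polyMleq _ _))// size_polyX size_P/= ltnS.
Qed.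

Lemma orthonormal_P0 : L 1 = 1 -> P 0 = 1.
Proof.
move=> L1; have /eqP/size_poly1P[c c0 PE] := size_P 0.
have := lead_P 0; rewrite PE lead_coefC => cpos.
have := ortho_P 0 0; rewrite PE eqxx -polyCM -[_%:P]mulr1 mul_polyC linearZ/= L1 mulr1.
move=> /eqP; rewrite -expr2 sqrp_eq1 ?ltW// => /eqP ->.
by [].
Qed.

Hypothesis L_stieltjes : forall p, 0 <= L ('X * (p * p)).

(** If the value were 0, [p] would minimize a nonnegative quadratic form; moving [p] in the
    direction [X p] gives a first-order term [2 e L((X p)^2)], negative for [e < 0]. *)
Lemma functional_X_sqr_gt0 p : p != 0 -> 0 < L ('X * (p * p)).
Proof.
move=> p0; rewrite lt_neqAle L_stieltjes andbT; apply/eqP => /esym L0.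
pose g := 'X * p; have g0 : g != 0 by rewrite mulf_neq0// polyX_eq0.
have Lg := functional_sqr_gt0 g0.
pose u := L (g * g); pose v := L ('X * (g * g)).
have v0 : 0 <= v by exact: L_stieltjes.
(* The form at [p + e X p] is [e (2 u + e v)]. This [e] is negative and gives
   [2 u + e v = u - e > 0]. *)
pose e := - u / (v + 1).
have := L_stieltjes (p + e *: g).
have -> : 'X * ((p + e *: g) * (p + e *: g)) =
   'X * (p * p) + (2 * e) *: (g * g) + (e ^+ 2) *: ('X * (g * g)).
  rewrite /g -!mul_polyC !rmorphM/= rmorph_nat; ring.
rewrite !linearD/= !linearZ/= L0 add0r -/u -/v => h.
have v1 : 0 < v + 1 by rewrite ltr_wpDl.
have : e * (v + 1) = - u by rewrite /e divfK// gt_eqF.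
have eneg : e < 0 by rewrite /e mulNr oppr_lt0 divr_gt0.
move=> h2; have : 0 <= e * (2 * u + e * v) by move: h; rewrite expr2; lra.
rewrite nmulr_rge0//; have : e * v = - u - e by lra.
move: Lg; rewrite -/u; lra.
Qed.

(* If P_n = (X - r) g then 0 = L (g P_n) = L (X g^2) - r L (g^2). *)
Lemma orthonormal_root_gt0 n r : root (P n) r -> 0 < r.
Proof.
move=> /factor_theorem[g gE]; rewrite ltNge; apply/negP => r0.
have P0 : P n != 0 by rewrite -size_poly_eq0 size_P.
have g0 : g != 0 by apply: contraNneq P0 => g0; rewrite gE g0 mul0r.
have : L (g * P n) = 0.
  apply: orthonormal_low; have := size_P n.
  by rewrite gE size_Mmonic ?monicXsubC// size_XsubC addn2/= => -[->].
have -> : g * P n = 'X * (g * g) - r *: (g * g).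
  by rewrite gE -mul_polyC; ring.
rewrite linearB/= linearZ/=; have := functional_X_sqr_gt0 g0.
have := functional_sqr_gt0 g0; nra.
Qed.

End OrthonormalPolynomials.

(** * Bessel's inequality for Cauchy kernels *)

Section CauchyTransform.
Variables (R : realType) (s : nat -> R) (mu : probability R R).
Hypothesis mus : has_moments s mu.
Implicit Types (p : {poly R}) (f : R -> R).

Notation L := (moment_functional s).

Lemma moment_functional1 : s 0 = 1 -> L 1 = 1.
Proof. by move=> s0; rewrite /moment_functional size_poly1 big_ord1 coef1 mul1r. Qed.

Section Bessel.
Variables (f : R -> R) (M : R) (P : nat -> {poly R}).
Hypothesis mf : measurable_fun setT f.
Hypothesis fM : forall t, `|f t| <= M.
Hypothesis ortho_P : forall m n, L (P m * P n) = (m == n)%:R.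

Lemma intg_mul_poly p : mu.-integrable setT (EFin \o (fun t => f t * p.[t])).
Proof. by apply: bounded_mul_intg fM _ => //; exact: intg_poly mus p. Qed.

(** Let [g] be the Fourier sum of [f]. Expanding the integral of [(f - g)^2], which is nonnegative,
    bounds the sum by the integral of [f^2], itself at most [M^2] since the total mass is 1. *)
Lemma bessel n : \sum_(k < n) (\int[mu]_t (f t * (P k).[t])) ^+ 2 <= M ^+ 2.
Proof.
set c := fun k => \int[mu]_t (f t * (P k).[t]).
rewrite (_ : \sum_(k < n) _ = \sum_(k < n) c k ^+ 2)//.
pose g := \sum_(k < n) c k *: P k.
have fg : \int[mu]_t (f t * g.[t]) = \sum_(k < n) c k ^+ 2.
  transitivity (\int[mu]_t (\sum_(k < n) c k * (f t * (P k).[t]))).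
    apply: eq_Rintegral => t _; rewrite /g horner_sum mulr_sumr.
    by apply: eq_bigr => k _; rewrite hornerZ mulrCA.
  rewrite Rintegral_sum; last by move=> k; apply: intgZ; exact: intg_mul_poly.
  apply: eq_bigr => k _; rewrite RintegralZl//; last exact: intg_mul_poly.
have gg : L (g * g) = \sum_(k < n) c k ^+ 2.
  rewrite {2}/g mulr_sumr linear_sum/=; apply: eq_bigr => k _.
  by rewrite -scalerAr linearZ/= orthonormal_coef// expr2.
have iff : mu.-integrable setT (EFin \o (fun t => f t * f t)).
  by apply: bounded_mul_intg fM _ => //; exact: bounded_intg fM.
have ifg : mu.-integrable setT (EFin \o (fun t => - 2 * (f t * g.[t]))).
  by apply: intgZ; exact: intg_mul_poly.
have igg : mu.-integrable setT (EFin \o (fun t => (g * g).[t])).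
  exact: intg_poly mus (g * g).
have : 0 <= \int[mu]_t (f t * f t + - 2 * (f t * g.[t]) + (g * g).[t]).
  apply: Rintegral_ge0 => t _; have := sqr_ge0 (f t - g.[t]).
  by rewrite hornerM expr2; lra.
rewrite RintegralD//; last exact: intgD.
rewrite RintegralD// RintegralZl//; last exact: intg_mul_poly.
rewrite fg (Rintegral_poly mus) gg => h.
have : \int[mu]_t (f t * f t) <= M ^+ 2.
  apply: (@le_trans _ _ (\int[mu]_t cst (M ^+ 2) t)).
    apply: le_Rintegral => //; first exact: intg_cst.
    move=> t _; rewrite /= -expr2 -(real_normK (num_real (f t))).
    by rewrite !expr2; apply: ler_pM.
  rewrite Rintegral_cst// [X in fine X](_ : _ = 1%E) ?mulr1//.
  exact: probability_setT.
lra.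
Qed.

End Bessel.

Variable z : R[i].
Hypothesis z_nonreal : complex.Im z != 0.

Let kre t := complex.Re ((t%:C - z)^-1).
Let kim t := complex.Im ((t%:C - z)^-1).

Lemma normc_kernel t : normc ((t%:C - z)^-1) <= `|complex.Im z|^-1.
Proof.
rewrite normcV lef_pV2 ?posrE ?normr_gt0// ?normc_gt0 ?real_neq_nonreal//.
have := normc_ge_normIm (t%:C - z).
by rewrite raddfB/= sub0r normrN.
Qed.

Lemma kre_le t : `|kre t| <= `|complex.Im z|^-1.
Proof. exact: le_trans (normc_ge_normRe _) (normc_kernel t). Qed.

Lemma kim_le t : `|kim t| <= `|complex.Im z|^-1.
Proof. exact: le_trans (normc_ge_normIm _) (normc_kernel t). Qed.

Lemma kernel_measurable : measurable_fun setT kre /\ measurable_fun setT kim.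
Proof.
(* The polynomial [q] is [|t - z|^2], without real zero: both parts of the kernel are continuous
   rational functions. *)
pose q : {poly R} := ('X - (complex.Re z)%:P) ^+ 2 + ((complex.Im z) ^+ 2)%:P.
have q0 t : q.[t] != 0.
  rewrite /q hornerD horner_exp hornerXsubC hornerC gt_eqF//.
  by rewrite ltr_wpDl ?sqr_ge0// exprn_even_gt0.
have kreE : kre = fun t => ('X - (complex.Re z)%:P).[t] / q.[t].
  apply/funext => t; rewrite /kre /q; case: z => x y /=.
  by rewrite !hornerE sqrrN.
have kimE : kim = fun t => ((complex.Im z)%:P).[t] / q.[t].
  apply/funext => t; rewrite /kim /q; case: z => x y /=.
  by rewrite !hornerE sqrrN mulNr opprK.
have h p : measurable_fun setT (fun t => p.[t] / q.[t]).
  apply: continuous_measurable_fun => t; apply: cvgM; first exact: continuous_horner.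
  by apply: cvgV => //; exact: continuous_horner.
by split; [rewrite kreE|rewrite kimE]; exact: h.
Qed.

Let mkre := kernel_measurable.1.
Let mkim := kernel_measurable.2.

(** The integral of [p(t) / (t - z)], by components. At [p = 1] it is the Cauchy transform of [mu];
    at [P n] it is a Fourier coefficient of the kernel, to which Bessel's inequality applies. *)
Definition cauchy_transform p : R[i] :=
  (\int[mu]_t (kre t * p.[t])) +i* (\int[mu]_t (kim t * p.[t])).

Let ire p := intg_mul_poly mkre kre_le p.
Let iim p := intg_mul_poly mkim kim_le p.

Lemma cauchy_transformD p q :
  cauchy_transform (p + q) = cauchy_transform p + cauchy_transform q.
Proof.
rewrite /cauchy_transform; apply/eqP; rewrite eq_complex/=; apply/andP; split; apply/eqP.
  rewrite -RintegralD//; try exact: ire.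
  by apply: eq_Rintegral => t _; rewrite hornerD mulrDr.
rewrite -RintegralD//; try exact: iim.
by apply: eq_Rintegral => t _; rewrite hornerD mulrDr.
Qed.

Lemma cauchy_transformZ (c : R) p :
  cauchy_transform (c *: p) = c%:C * cauchy_transform p.
Proof.
rewrite /cauchy_transform; apply/eqP; rewrite eq_complex/= !mul0r subr0 addr0.
apply/andP; split; apply/eqP.
  rewrite -RintegralZl//; try exact: ire.
  by apply: eq_Rintegral => t _; rewrite hornerZ mulrCA.
rewrite -RintegralZl//; try exact: iim.
by apply: eq_Rintegral => t _; rewrite hornerZ mulrCA.
Qed.

(* From t / (t - z) = 1 + z / (t - z). *)
Lemma cauchy_transformX p :
  cauchy_transform ('X * p) = z * cauchy_transform p + (L p)%:C.
Proof.
have kE t : t%:C * (t%:C - z)^-1 = 1 + z * (t%:C - z)^-1.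
  have h := real_neq_nonreal t z_nonreal.
  by rewrite -{1}(subrK z t%:C) mulrDl divff.
have kre_eq t : t * kre t = 1 + (complex.Re z * kre t - complex.Im z * kim t).
  have := congr1 (@complex.Re R) (kE t); rewrite raddfD /kre /kim /=.
  by case: ((t%:C - z)^-1) => u v; case: (z) => x y /=; rewrite mul0r subr0.
have kim_eq t : t * kim t = complex.Re z * kim t + complex.Im z * kre t.
  have := congr1 (@complex.Im R) (kE t); rewrite raddfD /kre /kim /=.
  by case: ((t%:C - z)^-1) => u v; case: (z) => x y /=; rewrite mul0r addr0 add0r.
rewrite /cauchy_transform; apply/eqP; rewrite eq_complex; apply/andP; split; apply/eqP.
  rewrite raddfD; case: (z) kre_eq => x y /= kre_eq.
  rewrite -(Rintegral_poly mus) -!RintegralZl//.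
  rewrite -RintegralB//; try by apply: intgZ.
  rewrite -RintegralD//; last 2 first.
  - rewrite [X in mu.-integrable _ X](_ : _ = EFin \o (fun t : R =>
      x * (kre t * p.[t]) + (- y) * (kim t * p.[t]))).
      by apply: intgD; exact: intgZ.
    by apply/funext => t /=; rewrite mulNr.
  - exact: intg_poly mus p.
  apply: eq_Rintegral => t _; rewrite hornerM hornerX mulrA (mulrC (kre t)) kre_eq.
  ring.
rewrite raddfD; case: (z) kim_eq => x y /= kim_eq; rewrite addr0.
rewrite -!RintegralZl// -RintegralD//; try by apply: intgZ.
apply: eq_Rintegral => t _; rewrite hornerM hornerX mulrA (mulrC (kim t)) kim_eq.
ring.
Qed.

Lemma cauchy_transform_sqsum (P : nat -> {poly R}) :
  (forall m n, L (P m * P n) = (m == n)%:R) ->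
  sqsum_bounded (fun k => cauchy_transform (P k)).
Proof.
move=> oP; exists (`|complex.Im z|^-1 ^+ 2 + `|complex.Im z|^-1 ^+ 2) => n.
under eq_bigr do rewrite normc_sqrE.
rewrite big_split/=; apply: lerD.
  exact: bessel mkre kre_le oP n.
exact: bessel mkim kim_le oP n.
Qed.

Section FirstSecondKind.
Variables (a b : nat -> R) (P Q : nat -> {poly R}).
Hypothesis b_gt0 : forall n, 0 < b n.
Hypothesis ortho_P : forall m n, L (P m * P n) = (m == n)%:R.
Hypothesis P0 : P 0 = 1.
Hypothesis P1 : 'X * P 0 = b 0 *: P 1 + a 0 *: P 0.
Hypothesis PS : forall n,
  'X * P n.+1 = b n.+1 *: P n.+2 + a n.+1 *: P n.+1 + b n *: P n.
Hypothesis Q0 : Q 0 = 0.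
Hypothesis Q1 : Q 1 = (b 0)^-1%:P.
Hypothesis QS : forall n,
  'X * Q n.+1 = b n.+1 *: Q n.+2 + a n.+1 *: Q n.+1 + b n *: Q n.

(** Both sides obey the same three-term recurrence: the extra term [L (P n)] of [cauchy_transformX]
    vanishes for [n > 0], and its value 1 at [n = 0] produces the initial value of [Q 1]. *)
Lemma cauchy_transform_P n : cauchy_transform (P n) =
  cauchy_transform 1 * eval_complex (P n) z + eval_complex (Q n) z.
Proof.
have bC m : (b m)%:C != 0 :> R[i] by rewrite fmorph_eq0 gt_eqF.
have L1 m : L (P m) = (m == 0)%:R by rewrite -[P m]mulr1 -P0 ortho_P.
suff [] : cauchy_transform (P n) =
    cauchy_transform 1 * eval_complex (P n) z + eval_complex (Q n) z /\
  cauchy_transform (P n.+1) =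
    cauchy_transform 1 * eval_complex (P n.+1) z + eval_complex (Q n.+1) z by [].
elim: n => [|n [IH0 IH1]].
  split.
    by rewrite P0 Q0 !eval_complexC mulr1 addr0.
  apply: (mulfI (bC 0)); have := cauchy_transformX (P 0).
  rewrite P1 !cauchy_transformD !cauchy_transformZ L1 P0/= => E2.
  have := congr1 (fun p => eval_complex p z) P1.
  rewrite eval_complexM eval_complexD !eval_complexZ P0 eval_complexX.
  rewrite eval_complexC mulr1 => E1; rewrite mulrDr mulrCA Q1 eval_complexC.
  rewrite -[X in _ = _ + X]rmorphM/= divff ?gt_eqF//.
  rewrite (_ : (b 0)%:C * eval_complex (P 1) z = z - (a 0)%:C); last first.
    by rewrite [in RHS]E1 rmorph1; ring.
  rewrite -[LHS](addrK ((a 0)%:C * cauchy_transform 1)) E2 rmorph1; ring.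
split => //; apply: (mulfI (bC n.+1)).
have := cauchy_transformX (P n.+1).
rewrite PS !cauchy_transformD !cauchy_transformZ L1 addr0 IH0 IH1.
have := congr1 (fun p => eval_complex p z) (PS n).
have := congr1 (fun p => eval_complex p z) (QS n).
rewrite !eval_complexM !eval_complexD !eval_complexZ eval_complexX.
move=> EQ EP EC; rewrite mulrDr [in RHS]mulrCA.
rewrite (_ : (b n.+1)%:C * eval_complex (P n.+2) z =
  z * eval_complex (P n.+1) z - (a n.+1)%:C * eval_complex (P n.+1) z
  - (b n)%:C * eval_complex (P n) z); last by rewrite EP; ring.
rewrite (_ : (b n.+1)%:C * eval_complex (Q n.+2) z =
  z * eval_complex (Q n.+1) z - (a n.+1)%:C * eval_complex (Q n.+1) z
  - (b n)%:C * eval_complex (Q n) z); last by rewrite EQ; ring.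
rewrite -[LHS](addrK ((a n.+1)%:C * (cauchy_transform 1 * eval_complex (P n.+1) z +
  eval_complex (Q n.+1) z) + (b n)%:C * (cauchy_transform 1 * eval_complex (P n) z +
  eval_complex (Q n) z))) addrA EC; ring.
Qed.

End FirstSecondKind.

End CauchyTransform.

(** * Transfer of square summability and complex limits *)

Section Transport.
Variables (R : realType) (a b : nat -> R) (z0 z : R[i]) (p q y : nat -> R[i]).
Hypothesis rec_p : forall n, z0 * p n.+1 =
  (b n.+1)%:C * p n.+2 + (a n.+1)%:C * p n.+1 + (b n)%:C * p n.
Hypothesis rec_q : forall n, z0 * q n.+1 =
  (b n.+1)%:C * q n.+2 + (a n.+1)%:C * q n.+1 + (b n)%:C * q n.
Hypothesis rec_y : forall n, z * y n.+1 =
  (b n.+1)%:C * y n.+2 + (a n.+1)%:C * y n.+1 + (b n)%:C * y n.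
Hypothesis wronskian_pq : forall n,
  (b n)%:C * (p n * q n.+1 - p n.+1 * q n) = 1.

(* The Christoffel-Darboux bracket. *)
Definition bracket (b : nat -> R) (u v : nat -> R[i]) n :=
  (b n)%:C * (u n.+1 * v n - u n * v n.+1).

Let D := bracket b y p.
Let B := bracket b y q.

(** Cross-multiply the two recurrences and subtract: the diagonal terms cancel. Summed over [n],
    this is the Christoffel-Darboux identity. *)
Lemma bracket_rec (v : nat -> R[i]) : (forall n, z0 * v n.+1 =
    (b n.+1)%:C * v n.+2 + (a n.+1)%:C * v n.+1 + (b n)%:C * v n) ->
  forall n, bracket b y v n.+1 =
    bracket b y v n + (z - z0) * (y n.+1 * v n.+1).
Proof.
move=> hv n; rewrite /bracket.
have := hv n; have := rec_y n.
move: (b n.+1)%:C (b n)%:C (a n.+1)%:C => c1 c0 d Ey Ev.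
rewrite mulrBl [z * _]mulrA Ey [z0 * _]mulrCA Ev; ring.
Qed.

(** Variation of constants: Cramer's rule in the basis [p], [q], whose Wronskian is 1. *)
Lemma bracket_solve n : y n.+1 = D n * q n.+1 - B n * p n.+1.
Proof.
rewrite -[LHS]mul1r -(wronskian_pq n) /D /B /bracket; ring.
Qed.

Let m n := normc (D n) + normc (B n).
Let r n := normc (p n) + normc (q n).

Let m_ge0 n : 0 <= m n. Proof. by rewrite addr_ge0 ?normc_ge0. Qed.
Let r_ge0 n : 0 <= r n. Proof. by rewrite addr_ge0 ?normc_ge0. Qed.

Let y_bound n : normc (y n.+1) <= m n * r n.+1.
Proof.
rewrite bracket_solve /m /r; move: (D n) (B n) => d e.
rewrite (le_trans (normc_leD _ _))// normcNE !normcM.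
rewrite -subr_ge0 (_ : _ - _ =
  normc d * normc (p n.+1) + normc e * normc (q n.+1)); last by ring.
by rewrite addr_ge0 ?mulr_ge0 ?normc_ge0.
Qed.

Let m_rec n : m n.+1 <= m n * (1 + normc (z - z0) * r n.+1 ^+ 2).
Proof.
have hD : normc (D n.+1) <=
    normc (D n) + normc (z - z0) * (normc (y n.+1) * normc (p n.+1)).
  rewrite /D (bracket_rec rec_p); move: (bracket b y p n) => d.
  by rewrite (le_trans (normc_leD _ _))// !normcM.
have hB : normc (B n.+1) <=
    normc (B n) + normc (z - z0) * (normc (y n.+1) * normc (q n.+1)).
  rewrite /B (bracket_rec rec_q); move: (bracket b y q n) => d.
  by rewrite (le_trans (normc_leD _ _))// !normcM.
apply: (@le_trans _ _ (m n + normc (z - z0) * (normc (y n.+1) * r n.+1))).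
  apply: (le_trans (lerD hD hB)); rewrite /m /r le_eqVlt; apply/orP; left.
  by apply/eqP; ring.
rewrite [leRHS]mulrDr mulr1 lerD2l [leRHS]mulrCA ler_wpM2l ?normc_ge0//.
by rewrite expr2 mulrA ler_wpM2r.
Qed.

(** A discrete Gronwall argument. The size [m n] of the coordinates of [y] in the basis [p], [q]
    grows at each step by at most the factor [1 + |z - z0| r_(n+1)^2]. As [r] is square summable,
    the product of these factors is bounded by an exponential, whence [|y_(n+1)| <= K r_(n+1)]. *)
Lemma sqsum_bounded_transport :
  sqsum_bounded p -> sqsum_bounded q -> sqsum_bounded y.
Proof.
move=> [Mp hp] [Mq hq]; pose S := 2 * (Mp + Mq).
have rS n : \sum_(k < n) r k ^+ 2 <= S.
  apply: (@le_trans _ _ (\sum_(k < n) 2 * (normc (p k) ^+ 2 + normc (q k) ^+ 2))).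
    apply: ler_sum => k _; rewrite /r.
    have := sqr_ge0 (normc (p k) - normc (q k)); rewrite !expr2; lra.
  rewrite -mulr_sumr; apply: ler_wpM2l => //; rewrite big_split/=.
  exact: lerD (hp n) (hq n).
have S0 : 0 <= S by have := rS 0; rewrite big_ord0.
pose c := normc (z - z0); have c0 : 0 <= c by exact: normc_ge0.
have mE n : m n <= m 0 * expR (c * \sum_(k < n.+1) r k ^+ 2).
  elim: n => [|n IH].
    by rewrite ler_peMr// -expR0 ler_expR mulr_ge0// sumr_ge0// => k _; exact: sqr_ge0.
  rewrite big_ord_recr/= mulrDr expRD mulrA.
  apply: (le_trans (m_rec n)); apply: ler_pM => //; last exact: expR_ge1Dx.
  by rewrite addr_ge0// mulr_ge0// sqr_ge0.
pose K := m 0 * expR (c * S).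
have mK n : m n <= K.
  by apply: (le_trans (mE n)); rewrite /K ler_wpM2l// ler_expR ler_wpM2l.
exists (normc (y 0) ^+ 2 + K ^+ 2 * S) => -[|n].
  rewrite big_ord0; apply: addr_ge0; first exact: sqr_ge0.
  by apply: mulr_ge0 => //; exact: sqr_ge0.
rewrite big_ord_recl; apply: lerD => //.
apply: (@le_trans _ _ (\sum_(k < n) K ^+ 2 * r k.+1 ^+ 2)).
  apply: ler_sum => k _.
  have h : normc (y k.+1) <= K * r k.+1.
    by apply: (le_trans (y_bound k)); rewrite ler_wpM2r.
  have := ler_pM (normc_ge0 _) (normc_ge0 _) h h.
  by rewrite -exprMn -!expr2.
rewrite -mulr_sumr ler_wpM2l ?sqr_ge0//; apply: le_trans (rS n.+1).
by rewrite big_ord_recl lerDr sqr_ge0.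
Qed.

End Transport.

Section ComplexLimits.
Variable R : realType.
Implicit Types (u v : nat -> R[i]) (l m : R[i]).

(** Componentwise convergence, which gives access to real limits; [ccvg_lim] returns to the topology
    used in the Nevanlinna series. *)
Definition ccvg u l :=
  (fun n => complex.Re (u n)) @ \oo --> complex.Re l /\
  (fun n => complex.Im (u n)) @ \oo --> complex.Im l.

Lemma ccvg_cst l : ccvg (fun=> l) l.
Proof. by split; exact: cvg_cst. Qed.

Lemma ccvg_real (x : nat -> R) (c : R) : x @ \oo --> c ->
  ccvg (fun n => (x n)%:C) c%:C.
Proof. by move=> xc; split => //; exact: cvg_cst. Qed.

Lemma ccvgD u v l m : ccvg u l -> ccvg v m -> ccvg (fun n => u n + v n) (l + m).
Proof.
move=> [ur ui] [vr vi]; split; rewrite raddfD; under eq_fun do rewrite raddfD.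
  exact: cvgD.
exact: cvgD.
Qed.

Lemma ccvgN u l : ccvg u l -> ccvg (fun n => - u n) (- l).
Proof.
move=> [ur ui]; split; rewrite raddfN; under eq_fun do rewrite raddfN.
  exact: cvgN.
exact: cvgN.
Qed.

Lemma ccvgM u v l m : ccvg u l -> ccvg v m -> ccvg (fun n => u n * v n) (l * m).
Proof.
have ReM (x y : R[i]) : complex.Re (x * y) =
    complex.Re x * complex.Re y - complex.Im x * complex.Im y.
  by case: x y => [? ?] [? ?].
have ImM (x y : R[i]) : complex.Im (x * y) =
    complex.Re x * complex.Im y + complex.Im x * complex.Re y.
  by case: x y => [? ?] [? ?].
move=> [ur ui] [vr vi]; split.
  rewrite ReM; under eq_fun do rewrite ReM.
  by apply: cvgB; exact: cvgM.
rewrite ImM; under eq_fun do rewrite ImM.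
by apply: cvgD; exact: cvgM.
Qed.

Lemma normc_le_ReIm l : normc l <= `|complex.Re l| + `|complex.Im l|.
Proof.
rewrite -ler_sqr ?nnegrE ?normc_ge0 ?addr_ge0// normc_sqrE.
rewrite -(real_normK (num_real (complex.Re l))) -(real_normK (num_real (complex.Im l))).
have := normr_ge0 (complex.Re l); have := normr_ge0 (complex.Im l).
move: `|_| `|_| => x y x0 y0; rewrite !expr2; nra.
Qed.

Lemma ccvg_dist u l : ccvg u l -> (fun n => normc (l - u n)) @ \oo --> 0.
Proof.
move=> [ur ui]; apply: (@squeeze_cvgr _ _ _ _ (cst 0)
  (fun n => `|complex.Re l - complex.Re (u n)| + `|complex.Im l - complex.Im (u n)|)).
- apply: nearW => n; rewrite normc_ge0/= -!raddfB; exact: normc_le_ReIm.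
- exact: cvg_cst.
have h (x : nat -> R) (c : R) : x @ \oo --> c -> `|c - x n| @[n --> \oo] --> `|0 : R|.
  move=> xc; apply: cvg_norm; rewrite -(subrr c).
  by apply: cvgB => //; exact: cvg_cst.
suff : `|complex.Re l - complex.Re (u n)| + `|complex.Im l - complex.Im (u n)|
    @[n --> \oo] --> `|0 : R| + `|0 : R| by rewrite normr0 addr0.
by apply: cvgD; exact: h.
Qed.

Lemma ccvg_norm u l : ccvg u l -> (fun n => normc (u n)) @ \oo --> normc l.
Proof.
move=> /ccvg_dist ul; apply/cvgrPdist_le => e e0.
move/cvgrPdist_le : ul => /(_ e e0); apply: filterS => n.
rewrite sub0r normrN ger0_norm ?normc_ge0// => h.
apply: le_trans h; rewrite ler_norml; apply/andP; split; last exact: normc_leB.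
by rewrite lerNl opprB -(normcNE (l - u n)) opprB normc_leB.
Qed.

Lemma ccvg_lim u l : ccvg u l ->
  limn (u : nat -> (R[i] : numFieldType)) = l.
Proof.
move=> /ccvg_dist ul; apply: cvg_lim; first exact: norm_hausdorff.
apply/cvgrPdist_lt => e e0.
(* The radius [e] is a positive element of [R[i]], hence real. *)
have eE : e = (complex.Re e)%:C by rewrite RRe_real// gtr0_real.
have re0 : 0 < complex.Re e by move: e0; rewrite eE ltcR.
move/cvgrPdist_lt : ul => /(_ _ re0); apply: filterS => n.
rewrite sub0r normrN ger0_norm ?normc_ge0// => h.
by rewrite eE; move: h; rewrite -ltcR.
Qed.

Lemma ccvg_unique u l m : ccvg u l -> ccvg u m -> l = m.
Proof. by move=> /ccvg_lim <- /ccvg_lim. Qed.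

Lemma bounded_series_cvg (x : nat -> R) (M : R) :
  (forall n, \sum_(k < n) `|x k| <= M) -> cvgn (series x).
Proof.
move=> xM; apply: normed_cvg; apply: nondecreasing_is_cvgn.
  by apply: nondecreasing_series => n _ _; exact: normr_ge0.
by exists M => _ [n _ <-]; have := xM n; rewrite -(big_mkord xpredT (fun k => `|x k|)).
Qed.

(** Absolute convergence, from [|u v| <= |u|^2 + |v|^2]. *)
Lemma ccvg_series u v : sqsum_bounded u -> sqsum_bounded v ->
  exists l, ccvg (series (fun k => u k * v k)) l.
Proof.
move=> [M uM] [N vN].
have nM n : \sum_(k < n) normc (u k * v k) <= M + N.
  apply: (@le_trans _ _ (\sum_(k < n) (normc (u k) ^+ 2 + normc (v k) ^+ 2))).
    apply: ler_sum => k _; rewrite normcM.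
    have := sqr_ge0 (normc (u k) - normc (v k)).
    have := normc_ge0 (u k); have := normc_ge0 (v k); rewrite !expr2; nra.
  by rewrite big_split lerD.
have cr : cvgn (series (fun k => complex.Re (u k * v k))).
  apply: (@bounded_series_cvg _ (M + N)) => n; apply: le_trans (nM n).
  by apply: ler_sum => k _; exact: normc_ge_normRe.
have ci : cvgn (series (fun k => complex.Im (u k * v k))).
  apply: (@bounded_series_cvg _ (M + N)) => n; apply: le_trans (nM n).
  by apply: ler_sum => k _; exact: normc_ge_normIm.
exists (limn (series (fun k => complex.Re (u k * v k))) +i*
        limn (series (fun k => complex.Im (u k * v k)))); split => /=.
  rewrite [X in X @ _ --> _](_ : _ = series (fun k => complex.Re (u k * v k)))//.
  by apply/funext => n; rewrite /series/= raddf_sum.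
rewrite [X in X @ _ --> _](_ : _ = series (fun k => complex.Im (u k * v k)))//.
by apply/funext => n; rewrite /series/= raddf_sum.
Qed.

End ComplexLimits.

(** * Interlacing *)

Section Interlacing.
Variable R : rcfType.
Implicit Types (p q : {poly R}) (x y s t v : nat -> R).

Lemma increasing_below t n : (forall i, (i.+1 < n)%N -> t i < t i.+1) ->
  forall i j, (i < j < n)%N -> t i < t j.
Proof.
move=> h i; elim=> [|j IH]; first by rewrite ltn0.
rewrite ltnS => /andP[ij jn]; have tj := h j jn.
move: ij; rewrite leq_eqVlt => /predU1P[->//|ij].
by apply: lt_trans tj; apply: IH; rewrite ij ltnW.
Qed.

(** Exactly the [n - m] factors of index at least [m] are negative. *)
Lemma prod_root_sign x n m (r : R) : (m <= n)%N ->
  (forall i, (i < m)%N -> x i < r) ->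
  (forall i, (m <= i < n)%N -> r < x i) ->
  0 < (-1) ^+ (n - m) * \prod_(i < n) (r - x i).
Proof.
elim: n => [|n IH] mn xl xr.
  by rewrite big_ord0 mulr1; move: mn; rewrite leqn0 => /eqP->.
move: mn; rewrite leq_eqVlt => /predU1P[mE|mn].
  rewrite mE subnn mul1r prodr_gt0// => i _.
  by rewrite subr_gt0 xl// mE.
rewrite subSn// exprS big_ord_recr/=.
have := IH mn xl _; set A := (-1) ^+ _; set B := \prod_(i < n) _ => AB.
have h : r < x n by apply: xr; rewrite -ltnS mn ltnSn.
have {}AB : 0 < A * B by apply: AB => i /andP[mi ni]; apply: xr; rewrite mi ltnW.
by nra.
Qed.

(** The sign changes between consecutive points, so each of the [n] gaps contains a root, and the
    degree [n] leaves room for no other. *)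
Lemma interlacing_roots v n q : size q = n.+1 ->
  (forall i, (i < n)%N -> v i < v i.+1) ->
  (forall j, (j <= n)%N -> 0 < (-1) ^+ (n - j) * q.[v j]) ->
  exists t, (forall i, (i < n)%N -> v i < t i /\ t i < v i.+1) /\
    q = lead_coef q *: \prod_(i < n) ('X - (t i)%:P).
Proof.
move=> qn vinc vs.
have ex i : exists c, (i < n)%N -> (v i < c /\ c < v i.+1) /\ root q c.
  case: (ltnP i n) => [il|_]; last by exists 0.
  have : q.[v i] * q.[v i.+1] < 0.
    have := vs i (ltnW il); have := vs i.+1 il.
    rewrite -(subnSK il) exprS; set e := (-1) ^+ _.
    have ee : e * e = 1 by rewrite -expr2 sqrr_sign.
    move: (q.[_]) (q.[_]) => u w eu ew.
    have := mulr_gt0 eu ew; rewrite mulN1r.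
    have -> : e * w * (- e * u) = - (e * e * (u * w)) by ring.
    by rewrite ee mul1r oppr_gt0.
  move=> /(poly_ivtoo (ltW (vinc i il)))[c]; rewrite in_itv/= => /andP[c1 c2] rc.
  by exists c.
have [t tP] := choice ex; exists t; split; first by move=> i /tP[].
have tinc : forall i j, (i < j < n)%N -> t i < t j.
  apply: increasing_below => i il; have [[_ h1] _] := tP i (ltnW il).
  by have [[h2 _] _] := tP _ il; exact: lt_trans h2.
rewrite {1}(@all_roots_prod_XsubC _ q (mkseq t n)) ?size_mkseq//.
- rewrite /mkseq big_map -(big_mkord xpredT (fun i => 'X - (t i)%:P)).
  by rewrite /index_iota subn0.
- apply/allP => c /(nthP 0)[k]; rewrite size_mkseq => kn <-.
  by rewrite nth_mkseq//; case: (tP k kn).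
- rewrite uniq_rootsE map_inj_in_uniq ?iota_uniq// => i j.
  rewrite !mem_iota/= !add0n => il jl tE.
  have [ij|ij|//] := ltngtP i j.
    by have := tinc i j; rewrite ij jl tE ltxx => /(_ isT).
  by have := tinc j i; rewrite ij il tE ltxx => /(_ isT).
Qed.

Lemma sign_at_infinity q n (M : R) : size q = n.+1 -> 0 < lead_coef q ->
  exists2 A : R, M < A & 0 < q.[A] /\ 0 < (-1) ^+ n * q.[- A].
Proof.
move=> qn ql; have q0 : q != 0 by rewrite -size_poly_eq0 qn.
pose A := Num.max (cauchy_bound q) (M + 1); exists A.
  by rewrite lt_max ltrDl ltr01 orbT.
have cA : cauchy_bound q <= A by rewrite le_max lexx.
split.
  have := sgp_pinftyP (ge_cauchy_bound q0); move=> /(_ A).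
  rewrite in_itv/= cA => /(_ isT); rewrite /sgp_pinfty (gtr0_sg ql) => /eqP.
  by rewrite sgr_cp0.
have := sgp_minftyP (le_cauchy_bound q0); move=> /(_ (- A)).
rewrite in_itv/= lerN2 cA => /(_ isT); rewrite /sgp_minfty qn/= => h.
rewrite -sgr_cp0 sgrM h -sgrM mulrA -expr2 sqrr_sign mul1r.
by rewrite (gtr0_sg ql).
Qed.

(** The degree is [n + 1] and only [n] signs are given; the two missing ones are those near minus
    and plus infinity. *)
Lemma interlacing_roots_ext s n q : size q = n.+2 -> 0 < lead_coef q ->
  (forall i, (i.+1 < n)%N -> s i < s i.+1) ->
  (forall j, (j < n)%N -> 0 < (-1) ^+ (n - j) * q.[s j]) ->
  exists t, (forall i, (i < n)%N -> t i < s i /\ s i < t i.+1) /\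
    q = lead_coef q *: \prod_(i < n.+1) ('X - (t i)%:P).
Proof.
move=> qn ql sinc ss.
have [A MA [qA qNA]] := sign_at_infinity (\sum_(i < n) `|s i|) qn ql.
have sA i : (i < n)%N -> `|s i| < A.
  move=> il; apply: le_lt_trans MA; rewrite (bigD1 (Ordinal il))//= lerDl.
  by apply: sumr_ge0.
(* The test points are [- A], then the [s j], then [A], where [A] exceeds every [|s j|] because it
   exceeds their sum. *)
pose v i := if i is j.+1 then (if (j < n)%N then s j else A) else - A.
have A0 : 0 < A by apply: le_lt_trans MA; exact: sumr_ge0.
have [||t [tv qE]] := @interlacing_roots v n.+1 q qn.
- case=> [_|i]; rewrite /v/=.
    case: ifP => [/sA|_]; last by lra.
    by rewrite ltr_norml => /andP[].
  rewrite ltnS => il; rewrite il; case: ifP => [/sinc//|_].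
  by have := sA i il; rewrite ltr_norml => /andP[].
- case=> [_|j]; rewrite /v; first by rewrite subn0.
  rewrite subSS ltnS leq_eqVlt => /predU1P[->|jn].
    by rewrite ltnn subnn mul1r.
  by rewrite jn; exact: ss.
exists t; split => // i il; have [_] := tv i (ltnW il).
have [+ _] := tv i.+1 il.
by rewrite /v il.
Qed.

(** Two strictly sorted lists with the same members are equal. This identifies [kth_zero] with the
    roots located by sign changes. *)
Lemma rootsR_prod p (c : R) n t : c != 0 ->
  p = c *: \prod_(i < n) ('X - (t i)%:P) ->
  (forall i, (i.+1 < n)%N -> t i < t i.+1) -> rootsR p = mkseq t n.
Proof.
move=> c0 pE /increasing_below tinc.
have pE' : p = c *: \prod_(z <- mkseq t n) ('X - z%:P).
  rewrite pE /mkseq big_map -(big_mkord xpredT (fun i => 'X - (t i)%:P)).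
  by rewrite /index_iota subn0.
have p0 : p != 0.
  by rewrite pE' scaler_eq0 negb_or c0 monic_neq0// monic_prod_XsubC.
apply: (@irr_sorted_eq _ <%R).
- exact: lt_trans.
- exact: ltxx.
- exact: sorted_roots.
- rewrite /mkseq; apply/(sortedP 0) => i; rewrite size_map size_iota => il.
  rewrite !(nth_map 0%N) ?size_iota ?(ltnW il)// !nth_iota ?(ltnW il)//.
  by rewrite !add0n tinc ?ltnSn.
- move=> z; rewrite -(roots_on_rootsR p0 z) in_itv/= pE'.
  by rewrite rootZ// root_prod_XsubC.
Qed.

End Interlacing.

(** * Zeros of Jacobi sequences *)

Section JacobiZeros.
Variables (R : realType) (a b : nat -> R) (y : nat -> {poly R}).
Hypothesis b_gt0 : forall n, 0 < b n.
Hypothesis size_y0 : size (y 0) = 1.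
Hypothesis lead_y0 : 0 < lead_coef (y 0).
Hypothesis rec_y0 : 'X * y 0 = b 0 *: y 1 + a 0 *: y 0.
Hypothesis rec_y : forall n,
  'X * y n.+1 = b n.+1 *: y n.+2 + a n.+1 *: y n.+1 + b n *: y n.

Lemma jacobi_step_size n (p q r : {poly R}) (c d e : R) : 0 < c ->
  size p = n.+1 -> 0 < lead_coef p -> (size r <= n)%N ->
  'X * p = c *: q + d *: p + e *: r -> size q = n.+2 /\ 0 < lead_coef q.
Proof.
move=> c0 sp lp sr pE.
have qE : c *: q = 'X * p - (d *: p + e *: r) by rewrite pE; ring.
have p0 : p != 0 by rewrite -size_poly_eq0 sp.
have sXp : size ('X * p) = n.+2 by rewrite mulrC size_mulX// sp.
have slow : (size (d *: p + e *: r)%R <= n.+1)%N.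
  rewrite (leq_trans (size_polyD _ _))// geq_max.
  by rewrite !(leq_trans (size_scale_leq _ _)) ?sp// (leq_trans sr).
have sq : size (c *: q) = n.+2.
  by rewrite qE size_polyDl sXp// size_polyN ltnS.
have lq : lead_coef (c *: q) = lead_coef p.
  rewrite qE lead_coefDl ?sXp ?size_polyN ?ltnS//.
  by rewrite mulrC lead_coefMX.
split; first by rewrite -sq size_scale// gt_eqF.
by move: lp; rewrite -lq lead_coefZ pmulr_rgt0.
Qed.

Lemma jacobi_size_lead n : size (y n) = n.+1 /\ 0 < lead_coef (y n).
Proof.
suff [] : (size (y n) = n.+1 /\ 0 < lead_coef (y n)) /\
     (size (y n.+1) = n.+2 /\ 0 < lead_coef (y n.+1)) by [].
elim: n => [|n [[s0 l0] [s1 l1]]].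
  split=> //; apply: (@jacobi_step_size 0 (y 0) _ 0 (b 0) (a 0) 0) => //.
    by rewrite size_poly0.
  by rewrite scaler0 addr0.
split => //.
apply: (@jacobi_step_size n.+1 (y n.+1) _ (y n) (b n.+1) (a n.+1) (b n)) => //.
by rewrite s0.
Qed.

Let x n i := kth_zero (y n) i.+1.

Lemma horner_roots n r : y n = lead_coef (y n) *: \prod_(i < n) ('X - (x n i)%:P) ->
  (y n).[r] = lead_coef (y n) * \prod_(i < n) (r - x n i).
Proof.
move=> {1}->; rewrite hornerZ horner_prod; congr (_ * _).
by apply: eq_bigr => i _; rewrite hornerXsubC.
Qed.

(** The induction carries the alternation of the signs of [y m.+1] at the zeros of [y m]. It locates
    the zeros of [y m.+1], so [y m] alternates at these, and the recurrence hands the alternation on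
    to [y m.+2]. *)
Lemma jacobi_zeros n :
  [/\ y n = lead_coef (y n) *: \prod_(i < n) ('X - (x n i)%:P),
      forall i, (i.+1 < n)%N -> x n i < x n i.+1,
      forall i, (i < n)%N -> x n.+1 i < x n i /\ x n i < x n.+1 i.+1 &
      forall j, (j <= n)%N -> 0 < (-1) ^+ (n - j) * (y n).[x n.+1 j]].
Proof.
have step m : y m = lead_coef (y m) *: \prod_(i < m) ('X - (x m i)%:P) ->
    (forall i, (i.+1 < m)%N -> x m i < x m i.+1) ->
    (forall j, (j < m)%N -> 0 < (-1) ^+ (m - j) * (y m.+1).[x m j]) ->
  [/\ y m.+1 = lead_coef (y m.+1) *: \prod_(i < m.+1) ('X - (x m.+1 i)%:P),
    (forall i, (i < m)%N -> x m.+1 i < x m i /\ x m i < x m.+1 i.+1),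
    (forall i, (i.+1 < m.+1)%N -> x m.+1 i < x m.+1 i.+1),
    (forall j, (j <= m)%N -> 0 < (-1) ^+ (m - j) * (y m).[x m.+1 j]) &
    (forall j, (j < m.+1)%N -> 0 < (-1) ^+ (m.+1 - j) * (y m.+2).[x m.+1 j])].
  move=> ym xinc ysgn; have [sy ly] := jacobi_size_lead m.+1.
  have [lm_gt0] := (jacobi_size_lead m).2.
  have [t [tx tE]] := interlacing_roots_ext sy ly xinc ysgn.
  have tinc i : (i.+1 < m.+1)%N -> t i < t i.+1.
    by rewrite ltnS => im; have [h1 h2] := tx i im; exact: lt_trans h2.
  have tinc' := increasing_below tinc.
  have xt i : (i < m.+1)%N -> x m.+1 i = t i.
    move=> im; rewrite /x /kth_zero (rootsR_prod _ tE)// ?gt_eqF//.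
    by rewrite nth_mkseq.
  have s1 j : (j <= m)%N -> 0 < (-1) ^+ (m - j) * (y m).[x m.+1 j].
    move=> jm; rewrite (horner_roots _ ym) mulrCA pmulr_rgt0//.
    apply: prod_root_sign => // i; rewrite xt//.
      move=> ij; have [|_ h] := tx i; first exact: leq_trans jm.
      move: ij; rewrite leq_eqVlt => /predU1P[<-//|ij].
      by apply: (lt_trans h); apply: tinc'; rewrite ij ltnS.
    move=> /andP[ji im]; have [h _] := tx i im.
    move: ji; rewrite leq_eqVlt => /predU1P[->//|ji].
    by apply: lt_trans h; apply: tinc'; rewrite ji ltnS ltnW.
  split => //.
  - rewrite {1}tE; congr (_ *: _); apply: eq_bigr => i _; rewrite xt//.
  - by move=> i im; rewrite !xt// ?ltnS ?(ltnW im)//; exact: tx.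
  - by move=> i im; rewrite !xt// ?(ltnW im)//; exact: tinc.
  (* At a zero of [y m.+1] the recurrence reads [b_(m+1) y_(m+2) = - b_m y_m]. *)
  move=> j jm; have root0 : (y m.+1).[x m.+1 j] = 0.
    rewrite tE hornerZ horner_prod (bigD1 (Ordinal jm))//= xt// hornerXsubC.
    by rewrite subrr mul0r mulr0.
  have := congr1 (fun p : {poly R} => p.[x m.+1 j]) (rec_y m).
  rewrite !hornerE root0 !mulr0 addr0 => E.
  rewrite subSn// exprS; have := s1 j jm; set e := (-1) ^+ _.
  have := b_gt0 m; have := b_gt0 m.+1.
  move: E; move: (y m.+2).[_] (y m).[_] (b m) (b m.+1) => u w c d E d0 c0 ew.
  rewrite -(pmulr_rgt0 _ d0).
  have du : d * u = - (c * w) by lra.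
  have -> : d * (-1 * e * u) = - e * (d * u) by ring.
  rewrite du mulNr mulrN opprK mulrCA; exact: mulr_gt0.
have good m : [/\ y m = lead_coef (y m) *: \prod_(i < m) ('X - (x m i)%:P),
    (forall i, (i.+1 < m)%N -> x m i < x m i.+1) &
    (forall j, (j < m)%N -> 0 < (-1) ^+ (m - j) * (y m.+1).[x m j])].
  elim: m => [|m [h1 h2 h3]]; last by have [] := step m h1 h2 h3.
  split => //; have := size_y0 => /eqP/size_poly1P[c c0 ->].
  by rewrite big_ord0 lead_coefC alg_polyC.
by have [h1 h2 h3] := good n; have [] := step n h1 h2 h3.
Qed.

End JacobiZeros.

(** * Zeros of the polynomials of both kinds *)

Section SecondKind.
Variables (R : realType) (a b : nat -> R) (P Q : nat -> {poly R}).
Hypothesis b_gt0 : forall n, 0 < b n.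
Hypothesis P0 : P 0 = 1.
Hypothesis P1 : 'X * P 0 = b 0 *: P 1 + a 0 *: P 0.
Hypothesis PS : forall n,
  'X * P n.+1 = b n.+1 *: P n.+2 + a n.+1 *: P n.+1 + b n *: P n.
Hypothesis Q0 : Q 0 = 0.
Hypothesis Q1 : Q 1 = (b 0)^-1%:P.
Hypothesis QS : forall n,
  'X * Q n.+1 = b n.+1 *: Q n.+2 + a n.+1 *: Q n.+1 + b n *: Q n.

Lemma wronskian n : b n *: (P n * Q n.+1 - P n.+1 * Q n) = 1.
Proof.
elim: n => [|n IH].
  by rewrite P0 Q0 Q1 mulr0 subr0 mul1r -mul_polyC -polyCM mulfV// gt_eqF.
rewrite -IH; have := QS n; have := PS n; rewrite -!mul_polyC.
move: (b n.+1)%:P (b n)%:P (a n.+1)%:P => c1 c0 d EP EQ.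
have -> : c1 * (P n.+1 * Q n.+2 - P n.+2 * Q n.+1) =
    ('X * P n.+1 - c1 * P n.+2) * Q n.+1 - P n.+1 * ('X * Q n.+1 - c1 * Q n.+2).
  by ring.
by rewrite EP EQ; ring.
Qed.

Lemma eval_complex_wronskian (z : R[i]) n : (b n)%:C *
  (eval_complex (P n) z * eval_complex (Q n.+1) z -
   eval_complex (P n.+1) z * eval_complex (Q n) z) = 1.
Proof.
have := congr1 (fun p => eval_complex p z) (wronskian n).
by rewrite eval_complexZ eval_complexB !eval_complexM eval_complex1.
Qed.

Let x n i := kth_zero (P n) i.+1.
Let xd n i := kth_zero (Q n.+1) i.+1.

Lemma first_kind_zeros n :
  [/\ P n = lead_coef (P n) *: \prod_(i < n) ('X - (x n i)%:P),
      forall i, (i.+1 < n)%N -> x n i < x n i.+1,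
      forall i, (i < n)%N -> x n.+1 i < x n i /\ x n i < x n.+1 i.+1 &
      forall j, (j <= n)%N -> 0 < (-1) ^+ (n - j) * (P n).[x n.+1 j]].
Proof.
by apply: (@jacobi_zeros _ a b) => //; rewrite P0 ?size_poly1 ?lead_coef1.
Qed.

Let Q1' : 'X * Q 1 = b 1 *: Q 2 + a 1 *: Q 1.
Proof. by rewrite QS Q0 scaler0 addr0. Qed.

Let sizeQ1 : size (Q 1) = 1.
Proof. by rewrite Q1 size_polyC invr_eq0 gt_eqF. Qed.

Let leadQ1 : 0 < lead_coef (Q 1).
Proof. by rewrite Q1 lead_coefC invr_gt0. Qed.

(** The shifted sequence [Q n.+1] starts with a positive constant and is itself a Jacobi sequence,
    for coefficients shifted by one. *)
Lemma second_kind_zeros n :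
  [/\ Q n.+1 = lead_coef (Q n.+1) *: \prod_(i < n) ('X - (xd n i)%:P),
      forall i, (i.+1 < n)%N -> xd n i < xd n i.+1,
      forall i, (i < n)%N -> xd n.+1 i < xd n i /\ xd n i < xd n.+1 i.+1 &
      forall j, (j <= n)%N -> 0 < (-1) ^+ (n - j) * (Q n.+1).[xd n.+1 j]].
Proof.
by apply: (@jacobi_zeros _ (fun n => a n.+1) (fun n => b n.+1) (fun n => Q n.+1)).
Qed.

Lemma first_kind_lead n : 0 < lead_coef (P n).
Proof.
by apply: (jacobi_size_lead b_gt0 _ _ P1 PS n).2; rewrite P0 ?size_poly1 ?lead_coef1.
Qed.

Lemma second_kind_size_lead n : size (Q n.+1) = n.+1 /\ 0 < lead_coef (Q n.+1).
Proof.
exact: (@jacobi_size_lead _ (fun n => a n.+1) (fun n => b n.+1) (fun n => Q n.+1)).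
Qed.

(** At a zero of [P_(n+1)] the Wronskian reduces to [b_n P_n Q_(n+1) = 1]. There [Q_(n+1)] has the
    sign of [P_n], which alternates. *)
Lemma first_second_kind_interlacing n i : (i < n)%N ->
  x n.+1 i < xd n i /\ xd n i < x n.+1 i.+1.
Proof.
have [PE xinc _ _] := first_kind_zeros n.+1.
have [_ _ _ sgn] := first_kind_zeros n.
have [sQ lQ] := second_kind_size_lead n.
have root0 j : (j <= n)%N -> (P n.+1).[x n.+1 j] = 0.
  move=> jn; rewrite -ltnS in jn.
  rewrite PE hornerZ horner_prod (bigD1 (Ordinal jn))//=.
  by rewrite hornerXsubC subrr mul0r mulr0.
have [||t [xt tE]] := @interlacing_roots _ (x n.+1) n (Q n.+1) sQ.
- by move=> j jn; apply: xinc.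
- move=> j jn; have := congr1 (fun p : {poly R} => p.[x n.+1 j]) (wronskian n).
  rewrite !hornerE root0// mul0r subr0 => E.
  have := sgn j jn; set e := (-1) ^+ _ => ep.
  have bpq : 0 < b n * ((P n).[x n.+1 j] * (Q n.+1).[x n.+1 j]) by rewrite E.
  rewrite pmulr_rgt0// in bpq; rewrite -(pmulr_rgt0 _ ep).
  have ee : e * e = 1 by rewrite -expr2 sqrr_sign.
  have -> : forall u w : R, e * u * (e * w) = (e * e) * (u * w) by move=> u w; ring.
  by rewrite ee mul1r.
have xdt : forall i, (i < n)%N -> xd n i = t i.
  move=> k kn; rewrite /xd /kth_zero (rootsR_prod _ tE) ?nth_mkseq// ?gt_eqF//.
  move=> k' kn'; have [_ h1] := xt k' (ltnW kn'); have [h2 _] := xt k'.+1 kn'.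
  exact: lt_trans h2.
by move=> ni; rewrite xdt//; exact: xt.
Qed.

End SecondKind.

(** * Limits of zeros of finite products *)

Section ProductBounds.
Variable R : realType.
Implicit Types (h u t : nat -> R).

Lemma prod_le_expR h u n : (forall k, (k < n)%N -> 0 <= h k <= 1 + u k) ->
  \prod_(k < n) h k <= expR (\sum_(k < n) u k).
Proof.
elim: n => [_|n IH hu]; first by rewrite !big_ord0 expR0.
rewrite !big_ord_recr/= expRD; have /andP[h0 hn] := hu n (ltnSn n).
apply: ler_pM => //.
- by apply: prodr_ge0 => k _; case/andP: (hu k (ltnW (ltn_ord k))).
- by apply: IH => k kn; apply: hu; exact: ltnW.
- exact: le_trans hn (expR_ge1Dx _).
Qed.

(** Isolates the factor that will tend to 0 at a limit zero. Replacing it by 1 in the remaining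
    product lets the whole sum of [u] stay in the exponent. *)
Lemma prod_le_factor h u n j : (j < n)%N -> (forall k, (k < n)%N -> 0 <= u k) ->
  (forall k, (k < n)%N -> 0 <= h k <= 1 + u k) ->
  \prod_(k < n) h k <= h j * expR (\sum_(k < n) u k).
Proof.
move=> jn u0 hu; rewrite (bigD1 (Ordinal jn))//=.
apply: ler_wpM2l; first by case/andP: (hu j jn).
rewrite big_mkcond/=.
apply: (@prod_le_expR (fun k => if k != j then h k else 1)) => k kn.
by case: ifP => _; [exact: hu|rewrite ler01 lerDl u0].
Qed.

Lemma sum_le_prod1D t n : (forall k, (k < n)%N -> 0 <= t k) ->
  \sum_(k < n) t k <= \prod_(k < n) (1 + t k).
Proof.
(* The induction needs the stronger lower bound [1 + sum]. *)
move=> t0; apply: (@le_trans _ _ (1 + \sum_(k < n) t k)); first by rewrite lerDr.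
elim: n t0 => [|n IH] t0; first by rewrite !big_ord0 addr0.
rewrite !big_ord_recr/= addrA.
have S0 : 0 <= \sum_(k < n) t k.
  by apply: sumr_ge0 => k _; apply: t0; rewrite ltnS ltnW.
have tn := t0 n (ltnSn n).
have := IH (fun k kn => t0 k (ltnW kn)).
move: (\sum_(_ < _) _) (\prod_(_ < _) _) S0 => S p S0 Sp.
apply: (@le_trans _ _ ((1 + S) * (1 + t n))).
  by have := mulr_ge0 S0 tn; lra.
by apply: ler_wpM2r => //; rewrite addr_ge0.
Qed.

(** Weierstrass's product inequality, in a form that keeps the tails of the products away from 0. *)
Lemma prod_ge_1Bsum h t m n : (forall k, (m <= k < n)%N -> 0 <= h k) ->
  (forall k, (m <= k < n)%N -> 0 <= t k) ->
  (forall k, (m <= k < n)%N -> 1 - t k <= h k) ->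
  1 - \sum_(m <= k < n) t k <= \prod_(m <= k < n) h k.
Proof.
elim: n => [|n IH] h0 t0 ht; first by rewrite !big_geq// subr0.
have [mn|nm] := leqP m n; last by rewrite !big_geq// subr0.
rewrite !big_nat_recr//=.
have sub k : (m <= k < n)%N -> (m <= k < n.+1)%N.
  by move=> /andP[-> kn]; rewrite ltnS ltnW.
have nn : (m <= n < n.+1)%N by rewrite mn ltnSn.
have S0 : 0 <= \sum_(m <= k < n) t k.
  by rewrite big_nat_cond sumr_ge0// => k; rewrite andbT => /sub /t0.
have p0 : 0 <= \prod_(m <= k < n) h k.
  by rewrite big_nat_cond prodr_ge0// => k; rewrite andbT => /sub /h0.
have := IH (fun k kn => h0 k (sub k kn)) (fun k kn => t0 k (sub k kn))
  (fun k kn => ht k (sub k kn)).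
have := h0 n nn; have := t0 n nn; have := ht n nn.
move: (h n) (t n) (\sum_(_ <= _ < _) _) (\prod_(_ <= _ < _) _) S0 p0.
move=> a b S p S0 p0 ha b0 a0 Sp.
(* If [b] or [S] exceeds 1, the left side is negative; otherwise two nonnegative lower bounds are
   multiplied. *)
have [b1|b1] := leP b 1; last first.
  by apply: (@le_trans _ _ 0); [lra|rewrite mulr_ge0].
have [S1|S1] := leP S 1; last first.
  by apply: (@le_trans _ _ 0); [lra|rewrite mulr_ge0].
apply: (@le_trans _ _ ((1 - S) * (1 - b))).
  have := mulr_ge0 S0 b0; lra.
by apply: ler_pM => //; rewrite subr_ge0.
Qed.

Lemma cvg_prod_ord (h : nat -> nat -> R) (l : nat -> R) N :
  (forall k, (k < N)%N -> (fun n => h n k) @ \oo --> l k) ->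
  (fun n => \prod_(0 <= k < N) h n k) @ \oo --> \prod_(0 <= k < N) l k.
Proof.
elim: N => [_|N IH hl].
  by under eq_fun do rewrite big_geq//; rewrite big_geq//; exact: cvg_cst.
under eq_fun do rewrite big_nat_recr//=; rewrite big_nat_recr//=.
by apply: cvgM; [apply: IH => k kN; apply: hl; exact: ltnW|exact: hl].
Qed.

Lemma cvg_sum_range (h : nat -> nat -> R) (l : nat -> R) m N :
  (forall k, (m <= k < N)%N -> (fun n => h n k) @ \oo --> l k) ->
  (fun n => \sum_(m <= k < N) h n k) @ \oo --> \sum_(m <= k < N) l k.
Proof.
elim: N => [_|N IH hl].
  by under eq_fun do rewrite big_geq//; rewrite big_geq//; exact: cvg_cst.
have [mN|Nm] := leqP m N; last first.
  by under eq_fun do rewrite big_geq//; rewrite big_geq//; exact: cvg_cst.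
under eq_fun do rewrite big_nat_recr//=; rewrite big_nat_recr//=.
apply: cvgD; last by apply: hl; rewrite mN ltnSn.
by apply: IH => k /andP[mk kN]; apply: hl; rewrite mk ltnS ltnW.
Qed.

End ProductBounds.

Section RootLimits.
Variables (R : realType) (x : nat -> nat -> R) (c : nat -> R) (M : R).
Variables (xi : nat -> R) (F : R[i] -> R[i]) (w : R[i]).
Hypothesis x_gt0 : forall n k, (k < n)%N -> 0 < x n k.
Hypothesis x_dec : forall n k, (k < n)%N -> x n.+1 k <= x n k.
Hypothesis sum_inv_x : forall n, \sum_(1 <= k < n) (x n k)^-1 <= M.
Hypothesis x_lim : forall k, (fun n => x n k) @ \oo --> xi k.
Hypothesis f_lim : forall z,
  ccvg (fun n => (c n)%:C * \prod_(k < n) (z - (x n k)%:C)) (F z).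
Hypothesis F_neq0 : F w != 0.
Implicit Types z : R[i].

(* The first zero may tend to 0, so it alone is not normalized. *)
Let g n k z : R[i] := if k == 0 then (x n k)%:C - z else 1 - z / (x n k)%:C.
Let h z n k := normc (g n k z).
(** The constant left by normalization, from [z - x_0 = - (x_0 - z)] and
    [z - x_k = - x_k (1 - z / x_k)]. *)
Let d n := c n * \prod_(k < n) (if k == 0 :> nat then - 1 else - x n k).

Let f_norm n z : normc ((c n)%:C * \prod_(k < n) (z - (x n k)%:C)) =
  `|d n| * \prod_(k < n) h z n k.
Proof.
rewrite /d normrM -mulrA normcM normc_real; congr (_ * _).
rewrite normr_prod normc_prod -big_split/=; apply: eq_bigr => k _.
rewrite /h /g; case: ifP => _.
  by rewrite normrN1 mul1r -normcNE opprB.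
have x0 : (x n k)%:C != 0 :> R[i] by rewrite fmorph_eq0 gt_eqF// x_gt0.
rewrite -normc_real -normcM; congr normc.
by rewrite rmorphN/=; field.
Qed.

Let x_mono m n k : (k < m)%N -> (m <= n)%N -> x n k <= x m k.
Proof.
move=> km; elim: n => [|n IH]; first by rewrite leqn0 => /eqP <-.
rewrite leq_eqVlt => /predU1P[<-//|mn]; apply: le_trans (IH mn).
by apply: x_dec; exact: leq_trans km mn.
Qed.

Let xi_le n k : (k < n)%N -> xi k <= x n k.
Proof.
move=> kn; apply: cvgr_to_le (x_lim (k := k)) _.
by exists n => // m /=; exact: x_mono.
Qed.

Let inv_le n k : (0 < k < n)%N -> (x n k)^-1 <= M.
Proof.
move=> /andP[k0 kn]; apply: le_trans (sum_inv_x n).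
rewrite (bigD1_seq k) ?mem_index_iota ?k0 ?kn ?iota_uniq//= lerDl.
rewrite big_nat_cond sumr_ge0// => i /andP[/andP[_ ni] _].
by rewrite invr_ge0 ltW// x_gt0.
Qed.

Let M_ge0 : 0 <= M.
Proof. by have := sum_inv_x 0; rewrite big_geq. Qed.

(** For [0 < k < n] the bound on the sum of inverses forces [x n k >= 1 / M]. *)
Let xi_gt0 k : (0 < k)%N -> 0 < xi k.
Proof.
move=> k0; have M0 : 0 < M.
  apply: lt_le_trans (inv_le (n := k.+1) (k := k) _); rewrite ?k0 ?ltnSn//.
  by rewrite invr_gt0 x_gt0.
apply: (@lt_le_trans _ _ M^-1); first by rewrite invr_gt0.
apply: cvgr_to_ge (x_lim (k := k)) _; exists k.+1 => // n /= kn.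
by rewrite -[x n k]invrK lef_pV2 ?posrE ?invr_gt0 ?x_gt0// inv_le// k0.
Qed.

Let u z n k := if k == 0 then x n k + normc z else normc z / x n k.

Let h_ge0 z n k : 0 <= h z n k. Proof. exact: normc_ge0. Qed.

Let u_ge0 z n k : (k < n)%N -> 0 <= u z n k.
Proof.
move=> kn; rewrite /u; case: ifP => _.
  by rewrite addr_ge0 ?normc_ge0// ltW// x_gt0.
by rewrite divr_ge0 ?normc_ge0// ltW// x_gt0.
Qed.

Let norm_ratio z n k : (k < n)%N -> normc (z / (x n k)%:C) = normc z / x n k.
Proof.
by move=> kn; rewrite normcM normcV normc_real gtr0_norm// x_gt0.
Qed.

Let h_le z n k : (k < n)%N -> 0 <= h z n k <= 1 + u z n k.
Proof.
move=> kn; rewrite h_ge0/= /h /g /u; case: ifP => _; apply: le_trans (normc_leD _ _) _.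
  by rewrite normcNE normc_real gtr0_norm ?x_gt0// lerDr.
by rewrite normcNE norm_ratio// normc1.
Qed.

(** Bounds the sum of the [u z n k] uniformly in [n > 0]: [x 1 0] dominates all first zeros, and [M]
    the inverses of the others. *)
Let K z := x 1 0 + normc z + normc z * M.

Let sum_u z n : (0 < n)%N -> \sum_(k < n) u z n k <= K z.
Proof.
move=> n0; rewrite -(big_mkord xpredT) big_ltn// /K; apply: lerD.
  by rewrite lerD2r; exact: x_mono.
rewrite (eq_big_nat _ _ (F2 := fun k => normc z * (x n k)^-1)).
  by rewrite -mulr_sumr ler_wpM2l ?normc_ge0.
by move=> [|k].
Qed.

Let prod_h_le z n : (0 < n)%N -> \prod_(k < n) h z n k <= expR (K z).
Proof.
move=> n0; apply: le_trans (prod_le_expR (u := u z n) _) _; first exact: h_le.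
by rewrite ler_expR sum_u.
Qed.

Let prod_h_le_factor z n j : (j < n)%N ->
  \prod_(k < n) h z n k <= h z n j * expR (K z).
Proof.
move=> jn; apply: le_trans (prod_le_factor jn (u := u z n) _ _) _.
- exact: u_ge0.
- exact: h_le.
by rewrite ler_wpM2l// ler_expR sum_u// (leq_ltn_trans _ jn).
Qed.

Let norm_lim z : (fun n => `|d n| * \prod_(k < n) h z n k) @ \oo --> normc (F z).
Proof. by under eq_fun do rewrite -f_norm; exact: ccvg_norm. Qed.

(** At [w] the products are at most [exp (K w)] while [|d n|] times them tends to [|F w| > 0]. *)
Let d_lower : exists2 e, 0 < e & \forall n \near \oo, e <= `|d n|.
Proof.
have Fw : 0 < normc (F w) by rewrite normc_gt0.
exists (normc (F w) / 2 / expR (K w)); first by rewrite !divr_gt0 ?expR_gt0.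
have Fw2 : normc (F w) / 2 < normc (F w) by lra.
near=> n; rewrite ler_pdivrMr ?expR_gt0//.
have n0 : (0 < n)%N by near: n; exact: nbhs_infty_gt.
apply: (@le_trans _ _ (`|d n| * \prod_(k < n) h w n k)).
  by near: n; exact: (cvgr_ge _ (@norm_lim w) _ Fw2).
by rewrite ler_wpM2l// prod_h_le.
Unshelve. all: by end_near. Qed.

(** At [-1] every normalized factor has modulus at least 1, because the zeros are positive. *)
Let d_upper : exists C, \forall n \near \oo, `|d n| <= C.
Proof.
have F1 : normc (F (-1)) < normc (F (-1)) + 1 by lra.
exists (normc (F (-1)) + 1); near=> n.
apply: (@le_trans _ _ (`|d n| * \prod_(k < n) h (-1) n k)); last first.
  by near: n; exact: (cvgr_le _ (@norm_lim (-1)) _ F1).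
rewrite ler_peMr//; apply: (big_ind (fun p => 1 <= p)) => // [|k _].
  by move=> p q p1 q1; exact: mulr_ege1.
have kn := ltn_ord k.
rewrite /h /g; case: ifP => _.
  rewrite (_ : _ - _ = (x n k + 1)%:C); last by rewrite rmorphD rmorph1 opprK.
  by rewrite normc_real ger0_norm ?lerDr ?addr_ge0// ltW// x_gt0.
rewrite (_ : 1 - _ = (1 + (x n k)^-1)%:C); last first.
  by rewrite rmorphD rmorph1 fmorphV mulNr mul1r opprK.
by rewrite normc_real ger0_norm ?lerDl ?addr_ge0// invr_ge0 ltW// x_gt0.
Unshelve. all: by end_near. Qed.

Let h_lim z k : (fun n => h z n k) @ \oo -->
  normc (if k == 0 then (xi k)%:C - z else 1 - z / (xi k)%:C).
Proof.
apply: ccvg_norm; rewrite /g; case: k => [|k] /=.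
  by apply: ccvgD; [exact: ccvg_real|exact: ccvg_cst].
apply: ccvgD; first exact: ccvg_cst.
apply: ccvgN; apply: ccvgM; first exact: ccvg_cst.
rewrite -fmorphV; under eq_fun do rewrite -fmorphV.
by apply: ccvg_real; apply: cvgV => //; rewrite gt_eqF// xi_gt0.
Qed.

(** At [xi k] the factor of index [k] tends to 0, while [|d n|] and the product of the other factors
    stay bounded. *)
Lemma root_limits_zero k : F (xi k)%:C = 0.
Proof.
apply: eq0_normc; have [C dC] := d_upper; set z := (xi k)%:C.
have h0 : (fun n => h z n k) @ \oo --> (0 : R).
  have := @h_lim z k; rewrite /z; case: ifP => [_|k0]; first by rewrite subrr normc0.
  by rewrite divff ?subrr ?normc0// fmorph_eq0 gt_eqF// xi_gt0// lt0n k0.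
have up : (fun n => C * (h z n k * expR (K z))) @ \oo --> (0 : R).
  rewrite -[0 : R](mulr0 C); apply: cvgM; first exact: cvg_cst.
  by rewrite -[0 : R](mul0r (expR (K z))); apply: cvgM => //; exact: cvg_cst.
apply: cvg_unique (@norm_lim z) _ => //.
apply: (squeeze_cvgr _ (cvg_cst 0) up); near=> n.
have kn : (k < n)%N by near: n; exact: nbhs_infty_gt.
rewrite mulr_ge0 ?prodr_ge0//= ; apply: ler_pM => //.
- by rewrite prodr_ge0.
- by near: n.
- exact: prod_h_le_factor.
Unshelve. all: by end_near. Qed.

(** The bound [M] passes to the partial sums of [1 / xi k], so that this series converges and its
    tails are small. *)
Let tail_small e : 0 < e -> exists2 N, (0 < N)%N &
  forall n, \sum_(N <= k < n) (xi k)^-1 <= e.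
Proof.
move=> e0; pose S m := \sum_(1 <= k < m) (xi k)^-1.
have inv0 k : (0 < k)%N -> 0 <= (xi k)^-1.
  by move=> k0; rewrite invr_ge0 ltW// xi_gt0.
have SM m : S m <= M.
  have : (fun n => \sum_(1 <= k < m) (x n k)^-1) @ \oo --> S m.
    apply: cvg_sum_range => k /andP[k0 _].
    by apply: cvgV => //; rewrite gt_eqF// xi_gt0.
  move=> /cvgr_to_le; apply; exists m => // n /= mn.
  apply: le_trans (sum_inv_x n).
  have inv_x0 j : 0 <= \sum_(j <= k < n) (x n k)^-1.
    rewrite big_nat_cond sumr_ge0// => k /andP[/andP[_ kn] _].
    by rewrite invr_ge0 ltW// x_gt0.
  case: m mn => [|m] mn; first by rewrite big_geq.
  by rewrite [leRHS](@big_cat_nat _ _ _ m.+1)//= lerDl.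
have Snd : nondecreasing_seq S.
  apply/nondecreasing_seqP => -[|m]; rewrite /S; first by rewrite !big_geq.
  by rewrite [leRHS]big_nat_recr//= lerDl inv0.
have cS : cvgn S by apply: nondecreasing_is_cvgn => //; exists M => _ [n _ <-].
have Sl := nondecreasing_cvgn_le Snd cS.
have le : limn S - e < limn S by lra.
have [N _ NS] := cvgr_ge _ cS _ le.
exists N.+1 => // n; have [nN|Nn] := leqP n N.+1; first by rewrite big_geq// ltW.
have SE : S n = S N.+1 + \sum_(N.+1 <= k < n) (xi k)^-1.
  by rewrite /S (@big_cat_nat _ _ _ N.+1)//=; exact: ltnW.
have := Sl n; have := NS N.+1 (leqnSn N); rewrite SE; lra.
Qed.

(** The first [N] factors converge to a product [p > 0]. The others have a product of at least
    [1/2], uniformly in [n], because [xi k <= x n k] dominates their deviations from 1 by a tail of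
    the convergent series. With [d_lower], [|F z|] is bounded below. *)
Lemma root_limits_only z : (forall k, z != (xi k)%:C) -> F z != 0.
Proof.
move=> zxi; have [e e0 de] := d_lower.
(* Using [|z| + 1] in place of [|z|] keeps the tolerance [1 / (2 z1)] meaningful at [z = 0]. *)
pose z1 := normc z + 1; have z10 : 0 < z1 by rewrite ltr_wpDl ?normc_ge0.
have [|N N0 tail] := @tail_small ((2 * z1)^-1); first by rewrite invr_gt0 mulr_gt0.
pose hl k := normc (if k == 0 then (xi k)%:C - z else 1 - z / (xi k)%:C).
pose p := \prod_(0 <= k < N) hl k.
have p0 : 0 < p.
  apply: prodr_gt0 => k _; rewrite normc_gt0; case: ifP => k0.
    by rewrite subr_eq0 eq_sym.
  have xk : (xi k)%:C != 0 :> R[i] by rewrite fmorph_eq0 gt_eqF// xi_gt0// lt0n k0.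
  rewrite subr_eq0; apply: contraNneq (zxi k) => E.
  by rewrite -[z](divfK xk) -E mul1r.
have pl : (fun n => \prod_(0 <= k < N) h z n k) @ \oo --> p.
  by apply: cvg_prod_ord => k _; exact: h_lim.
have p2 : p / 2 < p by lra.
suff : e * (p / 2 * 2^-1) <= normc (F z).
  by move=> H; rewrite -normc_gt0; apply: lt_le_trans H; rewrite !mulr_gt0 ?divr_gt0.
apply: cvgr_to_ge (@norm_lim z) _; near=> n.
have Nn : (N <= n)%N by near: n; exact: nbhs_infty_ge.
apply: ler_pM; rewrite ?mulr_ge0 ?invr_ge0 ?(ltW e0) ?(ltW p0)//; first by near: n.
rewrite -(big_mkord xpredT) (@big_cat_nat _ _ _ N)//=.
apply: ler_pM; rewrite ?divr_ge0 ?(ltW p0)//.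
  by near: n; exact: (cvgr_ge _ pl _ p2).
apply: le_trans (prod_ge_1Bsum (t := u z n) _ _ _); last 3 first.
- by move=> k _; exact: h_ge0.
- by move=> k /andP[_ kn]; exact: u_ge0.
- move=> k /andP[Nk kn]; have k0 : k == 0 = false by rewrite gtn_eqF// (leq_trans N0).
  rewrite /u /h /g k0 -norm_ratio// -{1}(@normc1 R); exact: normc_leB.
suff : \sum_(N <= k < n) u z n k <= 2^-1 by lra.
apply: (@le_trans _ _ (normc z * \sum_(N <= k < n) (xi k)^-1)).
  rewrite mulr_sumr; apply: ler_sum_nat => k /andP[Nk kn].
  have k0 : (0 < k)%N by rewrite (leq_trans N0).
  rewrite /u gtn_eqF//; apply: ler_wpM2l; first exact: normc_ge0.
  by rewrite lef_pV2 ?posrE ?x_gt0 ?xi_gt0// xi_le.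
apply: (@le_trans _ _ (z1 * (2 * z1)^-1)).
  apply: ler_pM => //; rewrite ?normc_ge0// ?lerDl//.
  rewrite big_nat_cond sumr_ge0// => k /andP[/andP[Nk _] _].
  by rewrite invr_ge0 ltW// xi_gt0// (leq_trans N0).
by rewrite invfM mulrCA divff ?mulr1// gt_eqF.
Unshelve. all: by end_near. Qed.

Lemma root_limits z : F z = 0 <-> exists k, z = (xi k)%:C.
Proof.
split; last by move=> [k ->]; exact: root_limits_zero.
move=> Fz; apply/not_existsP => H; have := @root_limits_only z.
rewrite Fz eqxx => /(_ _)/negP; apply => //.
by move=> k; apply/eqP; exact: H.
Qed.

End RootLimits.

(** * Zeros of the Nevanlinna combinations *)

Section Limits.
Variable R : realType.
Implicit Types (u v : nat -> R[i]) (l : R[i]).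

Lemma ccvg_shiftS u l : ccvg (fun n => u n.+1) l <-> ccvg u l.
Proof.
rewrite /ccvg -(cvg_shiftS (fun n => complex.Re (u n))).
by rewrite -(cvg_shiftS (fun n => complex.Im (u n))).
Qed.

(** Monotonicity is only asked from some index on: [kth_zero] takes the default value 0 as long as
    the polynomial has too few zeros. *)
Lemma eventually_decreasing_cvg (u : nat -> R) N :
  (forall n, (N < n)%N -> 0 < u n /\ u n.+1 <= u n) -> cvgn u.
Proof.
move=> h; have : cvgn [sequence u (n + N.+1)%N]_n.
  apply: nonincreasing_is_cvgn.
    apply/nonincreasing_seqP => n /=; rewrite addSn; apply: (h _ _).2.
    by rewrite addnS ltnS leq_addl.
  exists 0 => _ [n _ <-] /=; apply: ltW; apply: (h _ _).1.
  by rewrite addnS ltnS leq_addl.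
by move=> /cvg_ex[/= l]; rewrite cvg_shiftn => ul; apply/cvg_ex; exists l.
Qed.

End Limits.

Section NevanlinnaZeros.
Variables (R : realType) (a b : nat -> R) (P Q : nat -> {poly R}).
Hypothesis b_gt0 : forall n, 0 < b n.
Hypothesis P0 : P 0 = 1.
Hypothesis P1 : 'X * P 0 = b 0 *: P 1 + a 0 *: P 0.
Hypothesis PS : forall n,
  'X * P n.+1 = b n.+1 *: P n.+2 + a n.+1 *: P n.+1 + b n *: P n.
Hypothesis Q0 : Q 0 = 0.
Hypothesis Q1 : Q 1 = (b 0)^-1%:P.
Hypothesis QS : forall n,
  'X * Q n.+1 = b n.+1 *: Q n.+2 + a n.+1 *: Q n.+1 + b n *: Q n.
Hypothesis P_roots_gt0 : forall n r, root (P n) r -> 0 < r.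
Hypothesis P_l2 : forall z, sqsum_bounded (fun k => eval_complex (P k) z).
Hypothesis Q_l2 : forall z, sqsum_bounded (fun k => eval_complex (Q k) z).
Implicit Types z : R[i].

Let Pz z n := eval_complex (P n) z.
Let Qz z n := eval_complex (Q n) z.
Let x n i := kth_zero (P n) i.+1.
Let xd n i := kth_zero (Q n.+1) i.+1.

Let Pz_rec z n : z * Pz z n.+1 =
  (b n.+1)%:C * Pz z n.+2 + (a n.+1)%:C * Pz z n.+1 + (b n)%:C * Pz z n.
Proof. exact: eval_complex_three_term PS n. Qed.

Let Qz_rec z n : z * Qz z n.+1 =
  (b n.+1)%:C * Qz z n.+2 + (a n.+1)%:C * Qz z n.+1 + (b n)%:C * Qz z n.
Proof. exact: eval_complex_three_term QS n. Qed.

Let Wz z n : (b n)%:C * (Pz z n * Qz z n.+1 - Pz z n.+1 * Qz z n) = 1.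
Proof. exact: eval_complex_wronskian b_gt0 P0 PS Q0 Q1 QS z n. Qed.

Let eval0 (p : {poly R}) : eval_complex p 0 = p.[0]%:C.
Proof. by rewrite -eval_complex_real rmorph0. Qed.

(** The increments of the bracket are the terms of the kernel series times [z]; [e] is the additive
    constant of the Nevanlinna function, 0 for [D] and [A], -1 for [B], 1 for [C]. *)
Let bracket_cvg z (y : nat -> {poly R}) (v : nat -> {poly R}) (e : R[i]) :
  (forall n, z * eval_complex (y n.+1) z = (b n.+1)%:C * eval_complex (y n.+2) z
    + (a n.+1)%:C * eval_complex (y n.+1) z + (b n)%:C * eval_complex (y n) z) ->
  (forall n, 0 * eval_complex (v n.+1) 0 = (b n.+1)%:C * eval_complex (v n.+2) 0
    + (a n.+1)%:C * eval_complex (v n.+1) 0 + (b n)%:C * eval_complex (v n) 0) ->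
  sqsum_bounded (fun k => eval_complex (y k) z) ->
  sqsum_bounded (fun k => eval_complex (v k) 0) ->
  bracket b (fun k => eval_complex (y k) z) (fun k => eval_complex (v k) 0) 0 =
    e + z * (eval_complex (y 0) z * eval_complex (v 0) 0) ->
  ccvg (bracket b (fun k => eval_complex (y k) z) (fun k => eval_complex (v k) 0))
    (e + z * kernel_series y v z).
Proof.
move=> yrec vrec yl2 vl2 base.
have [l sl] := ccvg_series yl2 vl2.
have -> : kernel_series y v z = l by exact: ccvg_lim sl.
have E n : bracket b (fun k => eval_complex (y k) z) (fun k => eval_complex (v k) 0) n
    = e + z * series (fun k => eval_complex (y k) z * eval_complex (v k) 0) n.+1.
  elim: n => [|n IH]; first by rewrite base /series/= big_nat1.
  rewrite (bracket_rec yrec vrec) IH subr0 -addrA -mulrDr.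
  by rewrite /series/= [in RHS]big_nat_recr.
rewrite (funext E).
exact: (ccvgD (ccvg_cst e) (ccvgM (ccvg_cst z) ((ccvg_shiftS _ l).2 sl))).
Qed.

Let b0P1 z : (b 0)%:C * Pz z 1 = z - (a 0)%:C.
Proof.
have := congr1 (fun p => eval_complex p z) P1.
rewrite /Pz eval_complexD eval_complexM !eval_complexZ eval_complexX P0.
by rewrite eval_complex1 !mulr1 => E; rewrite [in RHS]E addrK.
Qed.

Let b0Q1 z : (b 0)%:C * Qz z 1 = 1.
Proof. by rewrite /Qz Q1 eval_complexC -rmorphM divff ?gt_eqF// rmorph1. Qed.

Let Pz0 z : Pz z 0 = 1.
Proof. by rewrite /Pz P0 eval_complex1. Qed.

Let Qz0 z : Qz z 0 = 0.
Proof. by rewrite /Qz Q0 eval_complex0. Qed.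

Let base z : [/\ bracket b (Pz z) (Pz 0) 0 = 0 + z * (Pz z 0 * Pz 0 0),
  bracket b (Pz z) (Qz 0) 0 = -1 + z * (Pz z 0 * Qz 0 0),
  bracket b (Qz z) (Pz 0) 0 = 1 + z * (Qz z 0 * Pz 0 0) &
  bracket b (Qz z) (Qz 0) 0 = 0 + z * (Qz z 0 * Qz 0 0)].
Proof.
rewrite /bracket !Pz0 !Qz0.
split; rewrite ?(mulr0, mul0r, mulr1, mul1r, addr0, add0r, subr0, sub0r)//.
- by rewrite mulrBr !b0P1; ring.
- by rewrite mulrN b0Q1.
- by rewrite oppr0 mulr0.
Qed.

Let D z := nevanlinnaD P z.
Let C z := nevanlinnaC P Q z.
Let B z := nevanlinnaB P Q z.
Let A z := nevanlinnaA Q z.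

Let lim_brackets z : [/\ ccvg (bracket b (Pz z) (Pz 0)) (D z),
  ccvg (bracket b (Pz z) (Qz 0)) (B z), ccvg (bracket b (Qz z) (Pz 0)) (C z) &
  ccvg (bracket b (Qz z) (Qz 0)) (A z)].
Proof.
have [h1 h2 h3 h4] := base z; rewrite /D /nevanlinnaD -[z * _]add0r.
rewrite /A /nevanlinnaA -[z * kernel_series Q Q z]add0r.
split; apply: bracket_cvg => //; exact: Pz_rec || exact: Qz_rec.
Qed.

(** Before the limit, this determinant of brackets is the product of the Wronskians at [z] and at
    0. *)
Let det_limit z : A z * D z - B z * C z = 1.
Proof.
have [lD lB lC lA] := lim_brackets z.
apply: ccvg_unique (ccvg_cst 1).
have := ccvgD (ccvgM lA lD) (ccvgN (ccvgM lB lC)).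
rewrite [X in ccvg X _ -> _](_ : _ = fun=> 1)//; apply/funext => n.
rewrite /bracket -[RHS](mulr1 1) -{1}(Wz z n) -(Wz 0 n); ring.
Qed.

Let P_eval n r : (P n).[r] = lead_coef (P n) * \prod_(i < n) (r - x n i).
Proof.
have [PE _ _ _] := first_kind_zeros b_gt0 P0 P1 PS n.
rewrite {1}PE hornerZ horner_prod; congr (_ * _).
by apply: eq_bigr => i _; rewrite hornerXsubC.
Qed.

Let Q_eval n r : (Q n.+1).[r] = lead_coef (Q n.+1) * \prod_(i < n) (r - xd n i).
Proof.
have [QE _ _ _] := second_kind_zeros b_gt0 Q0 Q1 QS n.
rewrite {1}QE hornerZ horner_prod; congr (_ * _).
by apply: eq_bigr => i _; rewrite hornerXsubC.
Qed.

Let x_gt0 n k : (k < n)%N -> 0 < x n k.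
Proof.
move=> kn; apply: (@P_roots_gt0 n); rewrite /root P_eval (bigD1 (Ordinal kn))//=.
by rewrite subrr mul0r mulr0.
Qed.

Let interlacing n k : (k < n)%N -> x n.+1 k < xd n k /\ xd n k < x n.+1 k.+1.
Proof. exact: first_second_kind_interlacing b_gt0 P0 P1 PS Q0 Q1 QS n k. Qed.

Let xd_gt0 n k : (k < n)%N -> 0 < xd n k.
Proof.
move=> kn; apply: lt_trans (interlacing kn).1; apply: x_gt0.
by rewrite ltnS ltnW.
Qed.

Let x_dec n k : (k < n)%N -> x n.+1 k <= x n k.
Proof.
have [_ _ h _] := first_kind_zeros b_gt0 P0 P1 PS n.
by move=> /h[/ltW].
Qed.

Let xd_dec n k : (k < n)%N -> xd n.+1 k <= xd n k.
Proof.
have [_ _ h _] := second_kind_zeros b_gt0 Q0 Q1 QS n.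
by move=> /h[/ltW].
Qed.

Let P_at0_sign n : 0 < (-1) ^+ n * (P n).[0].
Proof.
rewrite P_eval mulrCA mulr_gt0 ?(first_kind_lead b_gt0 P0 P1 PS)//.
rewrite -{1}(subn0 n); apply: prod_root_sign => // i /=; exact: x_gt0.
Qed.

Let Q_at0_sign n : 0 < (-1) ^+ n * (Q n.+1).[0].
Proof.
rewrite Q_eval mulrCA mulr_gt0 ?(second_kind_size_lead b_gt0 Q0 Q1 QS n).2//.
rewrite -{1}(subn0 n); apply: prod_root_sign => // i /=; exact: xd_gt0.
Qed.

Let Q_at0_neq0 n : (Q n.+1).[0] != 0.
Proof. by apply: contraTneq (Q_at0_sign n) => ->; rewrite mulr0 ltxx. Qed.

(** By the Wronskian, consecutive quotients differ by [- 1 / (b_n Q_n(0) Q_(n+1)(0))], positive as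
    the signs of [Q_n(0)] alternate. The quotients increase and are bounded above by 0. *)
Let alpha_cvg : (fun n => (P n).[0] / (Q n).[0]) @ \oo --> alpha P Q.
Proof.
(* The sequence is started at index 1 because [Q 0] is zero. *)
suff : cvgn [sequence (P n.+1).[0] / (Q n.+1).[0]]_n.
  move=> /cvg_ex[/= l].
  by rewrite (cvg_shiftS (fun n => (P n).[0] / (Q n).[0])) => h; apply: cvgP h.
have ee (n : nat) : (-1) ^+ n * (-1) ^+ n = 1 :> R by rewrite -expr2 sqrr_sign.
apply: nondecreasing_is_cvgn.
  apply/nondecreasing_seqP => n /=; rewrite -subr_ge0.
  have W := congr1 (fun p : {poly R} => p.[0]) (wronskian b_gt0 P0 PS Q0 Q1 QS n.+1).
  have := Q_at0_neq0 n.+1; have := Q_at0_neq0 n.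
  have := Q_at0_sign n.+1; have := Q_at0_sign n; have := b_gt0 n.+1.
  move: W; rewrite !hornerE exprS; set e := (-1) ^+ n => W.
  have {ee} := ee n; rewrite -/e; move: W.
  move: (b n.+1) (P n.+1).[0] (P n.+2).[0] (Q n.+1).[0] (Q n.+2).[0].
  move=> c p1 p2 q1 q2 W e2 c0 s1 s2 n1 n2.
  have q12 : 0 < - (q1 * q2).
    have -> : - (q1 * q2) = (e * e) * - (q1 * q2) by rewrite e2 mul1r.
    have -> : (e * e) * - (q1 * q2) = (e * q1) * (-1 * e * q2) by ring.
    exact: mulr_gt0.
  rewrite (_ : _ - _ = (c * (- (q1 * q2)))^-1).
    by rewrite invr_ge0 mulr_ge0 ?ltW.
  have cq : c * - (q1 * q2) != 0 by rewrite gt_eqF// mulr_gt0.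
  apply: (mulfI cq); rewrite divff// -W; field.
  by rewrite n1 n2.
exists 0 => _ [n _ <-] /=.
have := P_at0_sign n.+1; have := Q_at0_sign n; have := Q_at0_neq0 n.
rewrite exprS; move: (ee n); set e := (-1) ^+ n.
move: (P _).[0] (Q _).[0] => p q e2 q0 s1 s2.
have pq : 0 <= - (p * q).
  have -> : - (p * q) = (e * e) * - (p * q) by rewrite e2 mul1r.
  have -> : (e * e) * - (p * q) = (e * q) * (-1 * e * p) by ring.
  exact/ltW/mulr_gt0.
have -> : p / q = - (- (p * q) / (q * q)) by field.
by rewrite oppr_le0 divr_ge0// -expr2 sqr_ge0.
Qed.

Let F z := D z - B z * (alpha P Q)%:C.
Let G z := C z - A z * (alpha P Q)%:C.

Let F_lim z : ccvg (fun n => (lead_coef (P n) / (Q n).[0])%:C *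
  \prod_(k < n) (z - (x n k)%:C)) (F z).
Proof.
have [lD lB _ _] := lim_brackets z.
apply: (ccvg_shiftS _ _).1.
have := ccvgD lD (ccvgN (ccvgM lB ((ccvg_shiftS _ _).2 (ccvg_real alpha_cvg)))).
rewrite -/(F z) [X in ccvg X _ -> _](_ : _ = (fun n =>
  (lead_coef (P n.+1) / (Q n.+1).[0])%:C *
  \prod_(k < n.+1) (z - (x n.+1 k)%:C)))//.
apply/funext => n; have q0 : (Q n.+1).[0]%:C != 0 :> R[i] by rewrite fmorph_eq0.
(* This is [bracket_solve] with base point 0, before division by [Q_(n+1)(0)]. *)
have E : (lead_coef (P n.+1))%:C * \prod_(k < n.+1) (z - (x n.+1 k)%:C) =
    bracket b (Pz z) (Pz 0) n * (Q n.+1).[0]%:C -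
    bracket b (Pz z) (Qz 0) n * (P n.+1).[0]%:C.
  have [PE _ _ _] := first_kind_zeros b_gt0 P0 P1 PS n.+1.
  rewrite -!eval0 -(bracket_solve (Pz z) (Wz 0)) /Pz [in RHS]PE.
  by rewrite eval_complexZ eval_complex_prodXsubC.
rewrite [in RHS]rmorphM fmorphV [RHS]mulrAC E rmorphM fmorphV.
by field.
Qed.

Let G_lim z : ccvg (fun n => (lead_coef (Q n.+1) / (Q n.+1).[0])%:C *
  \prod_(k < n) (z - (xd n k)%:C)) (G z).
Proof.
have [_ _ lC lA] := lim_brackets z.
have := ccvgD lC (ccvgN (ccvgM lA ((ccvg_shiftS _ _).2 (ccvg_real alpha_cvg)))).
rewrite -/(G z) [X in ccvg X _ -> _](_ : _ = (fun n =>
  (lead_coef (Q n.+1) / (Q n.+1).[0])%:C *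
  \prod_(k < n) (z - (xd n k)%:C)))//.
apply/funext => n; have q0 : (Q n.+1).[0]%:C != 0 :> R[i] by rewrite fmorph_eq0.
have E : (lead_coef (Q n.+1))%:C * \prod_(k < n) (z - (xd n k)%:C) =
    bracket b (Qz z) (Pz 0) n * (Q n.+1).[0]%:C -
    bracket b (Qz z) (Qz 0) n * (P n.+1).[0]%:C.
  have [QE _ _ _] := second_kind_zeros b_gt0 Q0 Q1 QS n.
  rewrite -!eval0 -(bracket_solve (Qz z) (Wz 0)) /Qz [in RHS]QE.
  by rewrite eval_complexZ eval_complex_prodXsubC.
rewrite [in RHS]rmorphM fmorphV [RHS]mulrAC E rmorphM fmorphV.
by field.
Qed.

Let FG_det z : A z * F z - B z * G z = 1.
Proof. by rewrite -(det_limit z) /F /G; ring. Qed.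

(** At [-1] the normalized polynomial is the product of the [1 + 1 / xd n i]; it converges, hence is
    bounded, and it dominates the sum. *)
Let sum_inv_xd : exists M, forall n, \sum_(k < n) (xd n k)^-1 <= M.
Proof.
have /cvgP/cvg_seq_bounded/bounded_fun_has_ubound[M Mub] := ccvg_norm (G_lim (-1)).
exists M => n; apply: le_trans (Mub _ (ex_intro2 _ _ n I erefl)).
rewrite -(eval_complex_prodXsubC n (xd n)) -eval_complexZ.
have -> : (-1 : R[i]) = (-1)%:C by rewrite rmorphN rmorph1.
rewrite eval_complex_real normc_real hornerZ horner_prod.
under [X in _ * X]eq_bigr do rewrite hornerXsubC.
apply: le_trans (ler_norm _).
have := Q_eval n 0; set l := lead_coef _ => QE.
have -> : l / (Q n.+1).[0] * \prod_(i < n) (-1 - xd n i) =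
    \prod_(i < n) (1 + (xd n i)^-1).
  have l0 : l != 0 by rewrite gt_eqF// (second_kind_size_lead b_gt0 Q0 Q1 QS n).2.
  rewrite QE invfM mulrA divff// mul1r -prodfV -big_split/=.
  apply: eq_bigr => i _; have xi0 : xd n i != 0 by rewrite gt_eqF// xd_gt0.
  by field.
apply: (@sum_le_prod1D _ (fun k => (xd n k)^-1)) => k kn.
by rewrite invr_ge0 ltW// xd_gt0.
Qed.

Let xi k := limn (fun n => x n k).
Let xid k := limn (fun n => xd n k).

Let x_lim k : (fun n => x n k) @ \oo --> xi k.
Proof.
apply: (@eventually_decreasing_cvg _ (fun n => x n k) k) => n kn.
by split; [exact: x_gt0|exact: x_dec].
Qed.

Let xd_lim k : (fun n => xd n k) @ \oo --> xid k.
Proof.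
apply: (@eventually_decreasing_cvg _ (fun n => xd n k) k) => n kn.
by split; [exact: xd_gt0|exact: xd_dec].
Qed.

Lemma nevanlinna_zeros :
  [/\ forall k, (fun n => x n k) @ \oo --> xi k,
      forall k, (fun n => xd n k) @ \oo --> xid k,
      forall k, xi k < xid k /\ xid k < xi k.+1,
      forall z, F z = 0 <-> exists k, z = (xi k)%:C &
      forall z, G z = 0 <-> exists k, z = (xid k)%:C].
Proof.
have [M hM] := sum_inv_xd.
have hM1 n : \sum_(1 <= k < n) (xd n k)^-1 <= M.
  apply: le_trans (hM n); rewrite -(big_mkord xpredT (fun k => (xd n k)^-1)).
  case: n => [|n]; first by rewrite !big_geq.
  by rewrite [leRHS]big_ltn//= lerDr invr_ge0 ltW// xd_gt0.
(* Interlacing gives [x n.+1 k.+1 > xd n k], which transfers the bound to all zeros of [P n.+1] but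
   the first. *)
have hM2 n : \sum_(1 <= k < n) (x n k)^-1 <= M.
  case: n => [|n]; first by rewrite big_geq//; have := hM 0; rewrite big_ord0.
  apply: le_trans (hM n); rewrite big_add1 big_mkord; apply: ler_sum => k _ /=.
  have kn := ltn_ord k.
  by rewrite lef_pV2 ?posrE ?xd_gt0 ?x_gt0// ltW// (interlacing kn).2.
have G0 : G 0 != 0.
  by rewrite /G /A /C /nevanlinnaA /nevanlinnaC !mul0r addr0 subr0 oner_neq0.
have GP := root_limits xd_gt0 xd_dec hM1 xd_lim G_lim G0.
have Gxid k : G (xid k)%:C = 0 by apply/GP; exists k.
(* A point where [F] does not vanish is needed; at a zero of [G] the identity [A F - B G = 1]
   provides one. *)
have F0 : F (xid 0)%:C != 0.
  apply: contra_eq_neq (FG_det (xid 0)%:C) => ->.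
  by rewrite Gxid !mulr0 subr0 eq_sym oner_neq0.
have FP := root_limits x_gt0 x_dec hM2 x_lim F_lim F0.
have Fxi k : F (xi k)%:C = 0 by apply/FP; exists k.
have no_common k j : xi k != xid j.
  apply/eqP => E; have := FG_det (xi k)%:C; rewrite Fxi E Gxid !mulr0 subr0.
  by move/eqP; rewrite eq_sym oner_eq0.
(* Interlacing compares [P n.+1] with [Q n.+1], hence the shift. It gives weak inequalities in the
   limit, made strict by [no_common]. *)
have xS k : (fun n => x n.+1 k) @ \oo --> xi k by rewrite (cvg_shiftS (fun n => x n k)).
split=> // k; rewrite !lt_neqAle no_common [xid k == _]eq_sym no_common/=; split.
  rewrite -(cvg_lim (@Rhausdorff R) (xS k)) -(cvg_lim (@Rhausdorff R) (@xd_lim k)).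
  apply: ler_lim; [exact: cvgP (xS k)|exact: cvgP (@xd_lim k)|].
  by exists k.+1 => // n /= kn; exact/ltW/(interlacing kn).1.
rewrite -(cvg_lim (@Rhausdorff R) (xS k.+1)) -(cvg_lim (@Rhausdorff R) (@xd_lim k)).
apply: ler_lim; [exact: cvgP (@xd_lim k)|exact: cvgP (xS k.+1)|].
by exists k.+1 => // n /= kn; exact/ltW/(interlacing kn).2.
Qed.

End NevanlinnaZeros.

(** * Indeterminacy *)

Section Indeterminacy.
Variables (R : realType) (s : nat -> R).

(** The factor [t] may be replaced by [|t|], with which it agrees almost everywhere. *)
Lemma stieltjes_functional_ge0 (mu : probability R R) (p : {poly R}) :
  has_moments s mu -> mu [set t : R | t < 0] = 0%E ->
  0 <= moment_functional s ('X * (p * p)).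
Proof.
move=> mus mu0; rewrite -(Rintegral_poly mus).
rewrite (_ : \int[mu]_t _ = \int[mu]_t (`|t| * (p * p).[t])).
  apply: Rintegral_ge0 => t _.
  by rewrite mulr_ge0// hornerM -expr2 sqr_ge0.
rewrite /Rintegral; congr fine; apply: ae_eq_integral => //.
- by apply/measurable_EFinP; exact: measurable_horner.
- apply/measurable_EFinP; apply: measurable_funM; last exact: measurable_horner.
  exact: normr_measurable.
exists [set t : R | t < 0]; split => //.
  by rewrite (_ : [set t : R | t < 0] = `]-oo, 0[%classic).
move=> t /=; apply: contra_notT; rewrite -leNgt => t0 _.
by rewrite hornerM hornerX ger0_norm.
Qed.

Lemma determinate_of_transforms (mu nu : probability R R) :
  (forall z : R[i], complex.Im z != 0 ->
    cauchy_transform mu z 1 = cauchy_transform nu z 1) ->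
  forall a b : R, mu `]a, b]%classic = nu `]a, b]%classic.
Proof.
move=> H a b; apply: same_measure_itvoc => z z0.
have [mre mim] := kernel_measurable z0.
have := H z z0; rewrite /cauchy_transform => -[Hre Him].
have E (rho : probability R R) (f : R -> R) :
    \int[rho]_t (f t * (1 : {poly R}).[t]) = \int[rho]_t f t.
  by apply: eq_Rintegral => t _; rewrite hornerC mulr1.
split; split.
- exact: bounded_intg mre (kre_le z0).
- exact: bounded_intg mre (kre_le z0).
- by move: Hre; rewrite !E.
- exact: bounded_intg mim (kim_le z0).
- exact: bounded_intg mim (kim_le z0).
- by move: Him; rewrite !E.
Qed.

Variables (a b : nat -> R) (P Q : nat -> {poly R}).
Hypothesis b_gt0 : forall n, 0 < b n.
Hypothesis ortho_P : forall m n, moment_functional s (P m * P n) = (m == n)%:R.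
Hypothesis P0 : P 0 = 1.
Hypothesis P1 : 'X * P 0 = b 0 *: P 1 + a 0 *: P 0.
Hypothesis PS : forall n,
  'X * P n.+1 = b n.+1 *: P n.+2 + a n.+1 *: P n.+1 + b n *: P n.
Hypothesis Q0 : Q 0 = 0.
Hypothesis Q1 : Q 1 = (b 0)^-1%:P.
Hypothesis QS : forall n,
  'X * Q n.+1 = b n.+1 *: Q n.+2 + a n.+1 *: Q n.+1 + b n *: Q n.

(* Both w P + Q and w' P + Q are square summable at z by Bessel, and w <> w'. *)
Lemma transforms_differ_sqsum (mu nu : probability R R) (z : R[i]) :
  has_moments s mu -> has_moments s nu -> complex.Im z != 0 ->
  cauchy_transform mu z 1 != cauchy_transform nu z 1 ->
  sqsum_bounded (fun k => eval_complex (P k) z) /\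
  sqsum_bounded (fun k => eval_complex (Q k) z).
Proof.
move=> mus nus z0; set w := cauchy_transform mu z 1.
set w' := cauchy_transform nu z 1 => ww'.
have cm := cauchy_transform_sqsum mus z0 ortho_P.
have cn := cauchy_transform_sqsum nus z0 ortho_P.
have cmE k := cauchy_transform_P mus z0 b_gt0 ortho_P P0 P1 PS Q0 Q1 QS k.
have cnE k := cauchy_transform_P nus z0 b_gt0 ortho_P P0 P1 PS Q0 Q1 QS k.
have lP : sqsum_bounded (fun k => eval_complex (P k) z).
  have := sqsum_boundedZ (w - w')^-1 (sqsum_boundedD cm (sqsum_boundedZ (-1) cn)).
  rewrite [X in sqsum_bounded X -> _](_ : _ = fun k => eval_complex (P k) z)//.
  apply/funext => k; rewrite cmE cnE -/w -/w'.
  have ww0 : w - w' != 0 by rewrite subr_eq0.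
  by field.
split=> //; have := sqsum_boundedD cm (sqsum_boundedZ (- w) lP).
rewrite [X in sqsum_bounded X -> _](_ : _ = fun k => eval_complex (Q k) z)//.
by apply/funext => k; rewrite cmE -/w; ring.
Qed.

Lemma indeterminate_sqsum : indeterminate s -> forall z : R[i],
  sqsum_bounded (fun k => eval_complex (P k) z) /\
  sqsum_bounded (fun k => eval_complex (Q k) z).
Proof.
move=> [mu [nu [mus nus [E mE munu]]]] z.
(* If the transforms agreed at every nonreal point, the two solutions would coincide on all
   measurable sets. *)
have [z0 z0_nonreal ww'] : exists2 z0 : R[i], complex.Im z0 != 0 &
    cauchy_transform (std_prob mu) z0 1 != cauchy_transform (std_prob nu) z0 1.
  apply: contrapT => H; apply: munu; apply: probability_eq_itvoc => // c d.
  rewrite -!std_probE; apply: determinate_of_transforms => z0 z00.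
  by apply/eqP; apply: contra_notT H => h; exists z0.
have [lP lQ] := transforms_differ_sqsum (has_moments_std mus)
  (has_moments_std nus) z0_nonreal ww'.
have recP v := eval_complex_three_term v PS.
have recQ v := eval_complex_three_term v QS.
have W := eval_complex_wronskian b_gt0 P0 PS Q0 Q1 QS z0.
split.
  exact: (sqsum_bounded_transport (recP z0) (recQ z0) (recP z) W).
exact: (sqsum_bounded_transport (recP z0) (recQ z0) (recQ z) W).
Qed.

End Indeterminacy.

(** * From the moment problem to the Jacobi recurrences *)

Unset Implicit Arguments.

Theorem theorem4p1 (R : realType) (s : nat -> R)
    (mu : probability (measurableTypeR R) R) (P Q : nat -> {poly R}) :
  normalized_hamburger s -> indeterminate s -> stieltjes s ->
  solutions s mu -> orthonormal_polys mu P -> Q = second_kind mu P ->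
  exists xi xid : nat -> R,
    [/\ forall k, (0 < k)%N ->
          (fun n => kth_zero (P n) k) @ \oo --> xi k,
        forall k, (0 < k)%N ->
          (fun n => kth_zero (Q n.+1) k) @ \oo --> xid k,
        forall k, (0 < k)%N -> xi k < xid k /\ xid k < xi k.+1,
        forall z : R[i],
          nevanlinnaB P Q z * (alpha P Q)%:C - nevanlinnaD P z = 0 <->
          exists2 k, (0 < k)%N & z = (xi k)%:C &
        forall z : R[i],
          nevanlinnaA Q z * (alpha P Q)%:C - nevanlinnaC P Q z = 0 <->
          exists2 k, (0 < k)%N & z = (xid k)%:C].
Proof.
move=> [s0 _] s_indet [sigma sigma_s sigma_neg] mu_s [size_P lead_P orth] QE.
pose L := moment_functional s.
have mus := has_moments_std mu_s.
have intL (p : {poly R}) : \int[mu]_t p.[t] = L p.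
  by rewrite Rintegral_std ?(Rintegral_poly mus)//; exact: intg_poly mus p.
have ortho_P m n : L (P m * P n) = (m == n)%:R.
  by rewrite -intL -orth; apply: eq_Rintegral => t _; rewrite hornerM.
pose a n := L ('X * P n * P n); pose b n := L ('X * P n * P n.+1).
have aE : jacobi_a mu P = a.
  apply/funext => n; rewrite /a -intL; apply: eq_Rintegral => t _.
  by rewrite !hornerM hornerX -mulrA -expr2.
have bE : jacobi_b mu P = b.
  apply/funext => n; rewrite /b -intL; apply: eq_Rintegral => t _.
  by rewrite !hornerM hornerX.
have b_gt0 n : 0 < b n := jacobi_b_gt0 size_P lead_P ortho_P n.
have P0 : P 0 = 1.
  exact: (orthonormal_P0 size_P lead_P ortho_P (moment_functional1 s0)).
have P1 : 'X * P 0 = b 0 *: P 1 + a 0 *: P 0 := three_term0 size_P lead_P ortho_P.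
have PS n : 'X * P n.+1 = b n.+1 *: P n.+2 + a n.+1 *: P n.+1 + b n *: P n :=
  three_term size_P lead_P ortho_P n.
have Q0 : Q 0 = 0 by rewrite QE.
have Q1 : Q 1 = (b 0)^-1%:P by rewrite QE /second_kind /= bE.
have QS n : 'X * Q n.+1 = b n.+1 *: Q n.+2 + a n.+1 *: Q n.+1 + b n *: Q n.
  rewrite QE /second_kind aE bE /=; case: (second_kind_pair a b n) => q0 q1 /=.
  by rewrite scalerA divff ?gt_eqF// scale1r -!mul_polyC; ring.
(* Positivity comes from the solution [sigma] on the half-line and orthonormality from [mu]; they
   meet in [L], which depends on [s] only. *)
have L_ge0 p : 0 <= L ('X * (p * p)).
  exact: stieltjes_functional_ge0 (has_moments_std sigma_s) sigma_neg.
have l2 := indeterminate_sqsum b_gt0 ortho_P P0 P1 PS Q0 Q1 QS s_indet.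
have [h1 h2 h3 h4 h5] := nevanlinna_zeros b_gt0 P0 P1 PS Q0 Q1 QS
  (orthonormal_root_gt0 size_P lead_P ortho_P L_ge0)
  (fun z => (l2 z).1) (fun z => (l2 z).2).
(* Zeros are counted here from 1, in [nevanlinna_zeros] from 0: its [k]-th limit is the entry
   [k + 1] of these sequences. *)
exists (fun k => limn (fun n => kth_zero (P n) k)),
  (fun k => limn (fun n => kth_zero (Q n.+1) k)); split.
- by case=> [//|k _]; exact: h1.
- by case=> [//|k _]; exact: h2.
- by case=> [//|k _]; exact: h3.
(* The function in the statement is the opposite of the [F] of [nevanlinna_zeros]. *)
- move=> z; rewrite -opprB; split => [/eqP|].
    by rewrite oppr_eq0 => /eqP /h4 [k ->]; exists k.+1.
  by move=> [[//|k] _ zE]; apply/eqP; rewrite oppr_eq0; apply/eqP/h4; exists k.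
- move=> z; rewrite -opprB; split => [/eqP|].
    by rewrite oppr_eq0 => /eqP /h5 [k ->]; exists k.+1.
  by move=> [[//|k] _ zE]; apply/eqP; rewrite oppr_eq0; apply/eqP/h5; exists k.
Qed.
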